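(* Let $\mathbf{x}_1,\dots,\mathbf{x}_N\in\mathbb{R}^K$ be nonzero, let $\mathbf{T}$ be a real symmetric positive definite $K\times K$ matrix, let $\alpha_0\ge0$, and suppose that $P_N(S)<\frac{(1+\alpha_0)\dim(S)}{K}$ for every proper subspace $S\subseteq\mathbb{R}^K$. Let $\boldsymbol{\Sigma}_0$ be an arbitrary real symmetric positive definite $K\times K$ matrix and define, for $t\ge0$, $$\tilde{\boldsymbol{\Sigma}}_{t+1}=\frac{1}{1+\alpha_0}\frac KN\sum_{i=1}^N\frac{\mathbf{x}_i\mathbf{x}_i^T}{\mathbf{x}_i^T\boldsymbol{\Sigma}_t^{-1}\mathbf{x}_i}+\frac{\alpha_0}{1+\alpha_0}\frac{K\mathbf{T}}{\mathrm{Tr}(\boldsymbol{\Sigma}_t^{-1}\mathbf{T})},\qquad \boldsymbol{\Sigma}_{t+1}=\frac{\tilde{\boldsymbol{\Sigma}}_{t+1}}{\mathrm{Tr}(\tilde{\boldsymbol{\Sigma}}_{t+1})}.$$ Then the sequence $\{\boldsymbol{\Sigma}_t\}$ converges to a global minimizer (unique up to a positive scaling factor) of the problem of minimizing $$L^{\mathrm{Wiesel}}(\boldsymbol{\Sigma})=\log\det(\boldsymbol{\Sigma})+\frac KN\sum_{i=1}^N\log\left(\mathbf{x}_i^T\boldsymbol{\Sigma}^{-1}\mathbf{x}_i\right)+\alpha_0\left(K\log\left(\mathrm{Tr}(\boldsymbol{\Sigma}^{-1}\mathbf{T})\right)+\log\det(\boldsymbol{\Sigma})\right)$$ over $\bo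ldsymbol{\Sigma}\succcurlyeq\mathbf{0}$.
   Context: $P_N(S)=\frac1N\sum_{i=1}^N 1_{\{\mathbf{x}_i\in S\}}$ is the proportion of samples lying in $S$. ''Proper subspace'' means a linear subspace $S$ with $1\le\dim S\le K-1$. A function on positive definite matrices is assigned the value $+\infty$ at a singular positive semidefinite matrix when it tends to $+\infty$ there, so minimizing over $\boldsymbol{\Sigma}\succcurlyeq\mathbf 0$ (excluding the zero matrix, where the scale-invariant function $L^{\mathrm{Wiesel}}$ has no limit) amounts to minimizing over positive definite $\boldsymbol{\Sigma}$. *)

(* Defs.v *)
From mathcomp Require Import all_boot all_order all_algebra.
From mathcomp Require Import all_classical all_reals all_analysis.
Set Implicit Arguments.
Unset Strict Implicit.
Unset Printing Implicit Defensive.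
Import Order.TTheory GRing.Theory Num.Theory.
Import numFieldNormedType.Exports.
Local Open Scope classical_set_scope.
Local Open Scope ring_scope.

Definition quad_form (R : realType) (K : nat) (A : 'M[R]_K) (v : 'cV[R]_K) : R :=
  (v^T *m A *m v) 0 0.

Definition posdef (R : realType) (K : nat) : set 'M[R]_K :=
  [set A | A^T = A /\ forall v : 'cV[R]_K, v != 0 -> 0 < quad_form A v].

Definition possemidef (R : realType) (K : nat) : set 'M[R]_K :=
  [set A | A^T = A /\ forall v : 'cV[R]_K, 0 <= quad_form A v].

Definition sample_prop (R : realType) (K N : nat) (x : 'I_N -> 'cV[R]_K)
    (S : {vspace 'cV[R]_K}) : R :=
  N%:R^-1 * \sum_(i < N) (x i \in S)%:R.

Definition wiesel_cost (R : realType) (K N : nat) (x : 'I_N -> 'cV[R]_K)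
    (T : 'M[R]_K) (alpha0 : R) (Sigma : 'M[R]_K) : R :=
  ln (\det Sigma)
  + K%:R / N%:R * (\sum_(i < N) ln (quad_form (invmx Sigma) (x i)))
  + alpha0 * (K%:R * ln (\tr (invmx Sigma *m T)) + ln (\det Sigma)).

(* At a singular positive semidefinite matrix the cost is extended by its
   inferior limit along positive definite matrices; this is +oo exactly when
   the cost tends to +oo there. *)
Definition wiesel_cost_ext (R : realType) (K N : nat) (x : 'I_N -> 'cV[R]_K)
    (T : 'M[R]_K) (alpha0 : R) (Sigma : 'M[R]_K) : \bar R :=
  if `[< posdef Sigma >] then (wiesel_cost x T alpha0 Sigma)%:E
  else limf_einf (fun A : 'M[R]_K => (wiesel_cost x T alpha0 A)%:E)
                 (within (@posdef R K) (nbhs Sigma)).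

(* The zero matrix is excluded because the cost, being scale invariant, has no
   limit there. *)
Definition wiesel_minimizer (R : realType) (K N : nat) (x : 'I_N -> 'cV[R]_K)
    (T : 'M[R]_K) (alpha0 : R) : set 'M[R]_K :=
  [set Sigma | [/\ possemidef Sigma, Sigma != 0 &
    forall A : 'M[R]_K, possemidef A -> A != 0 ->
      (wiesel_cost_ext x T alpha0 Sigma <= wiesel_cost_ext x T alpha0 A)%E]].

Definition wiesel_update (R : realType) (K N : nat) (x : 'I_N -> 'cV[R]_K)
    (T : 'M[R]_K) (alpha0 : R) (Sigma : 'M[R]_K) : 'M[R]_K :=
  ((1 + alpha0)^-1 * (K%:R / N%:R)) *:
    (\sum_(i < N) (quad_form (invmx Sigma) (x i))^-1 *: (x i *m (x i)^T))
  + (alpha0 / (1 + alpha0)) *: ((\tr (invmx Sigma *m T))^-1 *: (K%:R *: T)).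

Definition wiesel_step (R : realType) (K N : nat) (x : 'I_N -> 'cV[R]_K)
    (T : 'M[R]_K) (alpha0 : R) (Sigma : 'M[R]_K) : 'M[R]_K :=
  (\tr (wiesel_update x T alpha0 Sigma))^-1 *: wiesel_update x T alpha0 Sigma.

Definition wiesel_iter (R : realType) (K N : nat) (x : 'I_N -> 'cV[R]_K)
    (T : 'M[R]_K) (alpha0 : R) (Sigma0 : 'M[R]_K) (t : nat) : 'M[R]_K :=
  iter t (wiesel_step x T alpha0) Sigma0.

(* Main.v *)
(* Write W = S^-1 and divide the cost by 1 + alpha0, so that it becomes
   ln det S + w sum_i ln (x_i^T W x_i) + b ln tr (W T)  with  w N + b = K.

   Descent. Since ln is concave, the update minimizes a majorant of the cost
   that is tight at S; hence the cost decreases strictly unless S is fixed.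

   Fixed points. Diagonalize a fixed point A and a competitor B simultaneously,
   to 1 and diag d. The fixed-point equation says that the weights coming from
   the x_i and T sum to 1 in each coordinate, and Jensen's inequality for ln
   gives cost A <= cost B. Equality forces d to be constant: for b > 0 because
   T is definite, and for b = 0 because otherwise the samples in an eigenspace
   would violate the bound on proper subspaces.

   Coercivity. Among the bases chosen from the x_i and the unit vectors, take
   one of minimal weighted sum of l(y) = ln (y^T W y). By exchange, each x_i
   lies in the span of the basis vectors y with l(y) <= l(x_i), so the subspace
   condition and Abel summation bound the cost below, up to a constant, by
   ln det S + sum_basis l + delta (max l - min l), while Hadamard's inequality
   bounds sum_basis l below by ln det W - const. A bound on the cost therefore bounds
   the condition number of S.

   Convergence. The normalized iterates stay in a compact set of positive
   definite matrices; their cluster points are fixed points of trace 1, and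
   these coincide by uniqueness. *)
Require Import Defs.
From mathcomp Require Import all_boot all_order all_algebra perm.
From mathcomp Require Import all_classical all_reals all_analysis.
From mathcomp Require Import ring lra.
Import Order.TTheory GRing.Theory Num.Theory.
Import numFieldNormedType.Exports.
Local Open Scope classical_set_scope.
Local Open Scope ring_scope.

Set Implicit Arguments.
Unset Strict Implicit.
Unset Printing Implicit Defensive.

(** * Convergence of matrix-valued functions *)

Section MatrixTopology.
Variable R : realType.

Lemma cvg_bigsum (V : normedModType R) (T : Type) (F : set_system T) (I : Type)
    (r : seq I) (P : pred I) (f : I -> T -> V) (l : I -> V) : Filter F ->
  (forall i, P i -> f i t @[t --> F] --> l i) ->
  \sum_(i <- r | P i) f i t @[t --> F] --> \sum_(i <- r | P i) l i.
Proof.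
move=> FF fl; elim: r => [|i r IH].
  by rewrite big_nil; under eq_fun do rewrite big_nil; exact: cvg_cst.
rewrite big_cons; under eq_fun do rewrite big_cons.
by case: ifPn => // Pi; apply: cvgD => //; exact: fl.
Qed.

Lemma cvg_bigprod (T : Type) (F : set_system T) (I : Type) (r : seq I)
    (f : I -> T -> R) (l : I -> R) : Filter F ->
  (forall i, f i t @[t --> F] --> l i) ->
  \prod_(i <- r) f i t @[t --> F] --> \prod_(i <- r) l i.
Proof.
move=> FF fl; elim: r => [|i r IH].
  by rewrite big_nil; under eq_fun do rewrite big_nil; exact: cvg_cst.
by rewrite big_cons; under eq_fun do rewrite big_cons; apply: cvgM.
Qed.

Lemma cvg_ln (U : Type) (F : set_system U) (f : U -> R) (a : R) : Filter F ->
  0 < a -> f t @[t --> F] --> a -> ln (f t) @[t --> F] --> ln a.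
Proof.
move=> FF a0 fa; apply: (@cvg_comp _ _ _ f (@ln R)); first exact: fa.
exact: continuous_ln.
Qed.

(** A neighbourhood of a matrix contains a product of entrywise neighbourhoods, and these are
    finitely many, so the filter meets all of them at once. *)
Lemma cvg_mx (T : Type) (F : set_system T) m n (f : T -> 'M[R]_(m, n))
    (A : 'M[R]_(m, n)) : Filter F ->
  (forall i j, f t i j @[t --> F] --> A i j) -> f t @[t --> F] --> A.
Proof.
move=> FF fA U [P AP PU].
have: \forall t \near F, forall ij : 'I_m * 'I_n, P ij.1 ij.2 (f t ij.1 ij.2).
  by apply: filter_forall => -[i j]; apply: fA; exact: AP.
by apply: filterS => t Pt; apply: PU => i j; exact: (Pt (i, j)).
Qed.

Lemma cvg_coord (T : Type) (F : set_system T) m n (f : T -> 'M[R]_(m, n))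
    (A : 'M[R]_(m, n)) i j : Filter F ->
  f t @[t --> F] --> A -> f t i j @[t --> F] --> A i j.
Proof.
move=> FF fA; apply: (@cvg_comp _ _ _ f (fun M : 'M[R]_(m, n) => M i j)).
  exact: fA.
exact: coord_continuous.
Qed.

Lemma cvg_mulmx (T : Type) (F : set_system T) m n p (f : T -> 'M[R]_(m, n))
    (g : T -> 'M[R]_(n, p)) (A : 'M[R]_(m, n)) (B : 'M[R]_(n, p)) : Filter F ->
  f t @[t --> F] --> A -> g t @[t --> F] --> B ->
  (f t *m g t) @[t --> F] --> A *m B.
Proof.
move=> FF fA gB; apply: cvg_mx => i j; rewrite mxE.
under eq_fun do rewrite mxE.
by apply: cvg_bigsum => k _; apply: cvgM; apply: cvg_coord.
Qed.

Lemma cvg_trmx (T : Type) (F : set_system T) m n (f : T -> 'M[R]_(m, n))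
    (A : 'M[R]_(m, n)) :
  Filter F -> f t @[t --> F] --> A -> (f t)^T @[t --> F] --> A^T.
Proof.
move=> FF fA; apply: cvg_mx => i j; rewrite mxE.
by under eq_fun do rewrite mxE; apply: cvg_coord.
Qed.

Lemma cvg_mxtrace (T : Type) (F : set_system T) n (f : T -> 'M[R]_n)
    (A : 'M[R]_n) :
  Filter F -> f t @[t --> F] --> A -> \tr (f t) @[t --> F] --> \tr A.
Proof. by move=> FF fA; apply: cvg_bigsum => i _; apply: cvg_coord. Qed.

Lemma cvg_det (T : Type) (F : set_system T) n (f : T -> 'M[R]_n)
    (A : 'M[R]_n) :
  Filter F -> f t @[t --> F] --> A -> \det (f t) @[t --> F] --> \det A.
Proof.
move=> FF fA; apply: cvg_bigsum => s _; apply: cvgM; first exact: cvg_cst.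
by apply: cvg_bigprod => i; apply: cvg_coord.
Qed.

Lemma cvg_adjugate (T : Type) (F : set_system T) n (f : T -> 'M[R]_n)
    (A : 'M[R]_n) :
  Filter F -> f t @[t --> F] --> A -> \adj (f t) @[t --> F] --> \adj A.
Proof.
move=> FF fA; apply: cvg_mx => i j; rewrite mxE.
under eq_fun do rewrite mxE.
apply: cvgM; first exact: cvg_cst.
apply: cvg_det; apply: cvg_mx => a b; rewrite !mxE.
by under eq_fun do rewrite !mxE; apply: cvg_coord.
Qed.

Lemma cvg_invmx (T : Type) (F : set_system T) n (f : T -> 'M[R]_n)
    (A : 'M[R]_n) :
  Filter F -> A \in unitmx ->
  f t @[t --> F] --> A -> invmx (f t) @[t --> F] --> invmx A.
Proof.
move=> FF uA fA; have dA : \det A != 0 by rewrite -unitfE -unitmxE.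
have cdet := cvg_det FF fA.
have near_unit : \forall t \near F, \det (f t) != 0.
  exact: (cvgr_neq0 _ cdet dA).
(* [invmx] is defined by cases; near the limit the determinants are nonzero, so only its adjugate
   branch matters there. *)
rewrite /invmx uA.
apply: (cvg_trans _ (cvgZ (cvgV dA cdet) (cvg_adjugate FF fA))).
apply: near_eq_cvg; near=> t.
rewrite unitmxE unitfE ifT //.
by near: t.
Unshelve. all: by end_near. Qed.

Lemma cvg_quad_form (T : Type) (F : set_system T) n (f : T -> 'M[R]_n)
    (A : 'M[R]_n)
    (v : 'cV[R]_n) : Filter F ->
  f t @[t --> F] --> A -> quad_form (f t) v @[t --> F] --> quad_form A v.
Proof.
move=> FF fA; apply: cvg_coord; apply: cvg_mulmx; last exact: cvg_cst.
by apply: cvg_mulmx => //; exact: cvg_cst.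
Qed.

(** Compactness of a product of segments, carried from row vectors to matrices by [vec_mx]. *)
Lemma compact_mx_box m n (c : R) :
  compact [set M : 'M[R]_(m, n) | forall i j, `|M i j| <= c].
Proof.
have cvec : continuous (@vec_mx R m n).
  move=> v; apply: (@cvg_mx _ _ _ _ _ _ (nbhs_filter v)) => i j; rewrite mxE.
  by under eq_fun do rewrite mxE; exact: coord_continuous.
have -> : [set M : 'M[R]_(m, n) | forall i j, `|M i j| <= c] =
    vec_mx @` [set v : 'rV[R]_(m * n) | forall i, v ord0 i \in `[(- c), c]].
  apply/seteqP; split=> [M AM|_ [v Av <-] i j /=].
    exists (mxvec M); last exact: mxvecK.
    move=> k; case/mxvec_indexP: k => i j.
    by rewrite mxvecE in_itv /= -ler_norml; exact: AM.
  by rewrite mxE ler_norml; have := Av (mxvec_index i j); rewrite in_itv.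
apply: continuous_compact; first exact: continuous_subspaceT.
by apply: (@rV_compact _ _ (fun=> `[(- c), c]%classic)) => _;
  exact: segment_compact.
Qed.

End MatrixTopology.

(** * Quadratic forms and simultaneous diagonalization *)

Section QuadraticForms.
Variable R : realType.

Lemma quad_formZ n (A : 'M[R]_n) a v : quad_form (a *: A) v = a * quad_form A v.
Proof. by rewrite /quad_form -scalemxAr -scalemxAl mxE. Qed.

Lemma quad_formD n (A B : 'M[R]_n) v :
  quad_form (A + B) v = quad_form A v + quad_form B v.
Proof. by rewrite /quad_form mulmxDr mulmxDl mxE. Qed.

Lemma quad_formB n (A B : 'M[R]_n) v :
  quad_form (A - B) v = quad_form A v - quad_form B v.
Proof. by rewrite /quad_form mulmxBr mulmxBl mxE [X in _ + X]mxE. Qed.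

Lemma quad_form_sum n (I : Type) (r : seq I) (A : I -> 'M[R]_n) v :
  quad_form (\sum_(i <- r) A i) v = \sum_(i <- r) quad_form (A i) v.
Proof. by rewrite /quad_form mulmx_sumr mulmx_suml summxE. Qed.

Lemma quad_form_scale n (A : 'M[R]_n) a v :
  quad_form A (a *: v) = a ^+ 2 * quad_form A v.
Proof.
rewrite /quad_form [(a *: v)^T]linearZ /= -!scalemxAl -scalemxAr scalerA mxE.
by rewrite expr2.
Qed.

Lemma quad_form_polar n (A : 'M[R]_n) u v :
  quad_form A (u + v) =
  quad_form A u + quad_form A v + (u^T *m A *m v) 0 0 + (v^T *m A *m u) 0 0.
Proof.
rewrite /quad_form [(u + v)^T]linearD /= !(mulmxDl, mulmxDr).
by rewrite !mxE; ring.
Qed.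

Lemma quad_form_congr m n (A : 'M[R]_n) (P : 'M[R]_(m, n)) v :
  quad_form (P *m A *m P^T) v = quad_form A (P^T *m v).
Proof. by rewrite /quad_form trmx_mul trmxK !mulmxA. Qed.

Lemma quad_form_diag n (d : 'rV[R]_n) v :
  quad_form (diag_mx d) v = \sum_j d 0 j * v j 0 ^+ 2.
Proof.
rewrite /quad_form mul_mx_diag mxE; apply: eq_bigr => j _.
by rewrite !mxE; ring.
Qed.

Lemma quad_form1 n (v : 'cV[R]_n) : quad_form 1%:M v = \sum_j v j 0 ^+ 2.
Proof.
by rewrite /quad_form mulmx1 mxE; apply: eq_bigr => j _; rewrite mxE expr2.
Qed.

Lemma quad_form1_ge0 n (v : 'cV[R]_n) : 0 <= quad_form 1%:M v.
Proof. by rewrite quad_form1 sumr_ge0 // => j _; rewrite sqr_ge0. Qed.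

Lemma quad_form1_eq0 n (v : 'cV[R]_n) : (quad_form 1%:M v == 0) = (v == 0).
Proof.
rewrite quad_form1; apply/eqP/eqP => [v0|->]; last first.
  by rewrite big1 // => j _; rewrite mxE expr0n.
apply/matrixP => j k; rewrite (ord1 k) mxE; apply/eqP; rewrite -sqrf_eq0.
apply/eqP; apply: (psumr_eq0P (P := xpredT)) v0 j isT => i _.
exact: sqr_ge0.
Qed.

Lemma quad_form_outer n (x v : 'cV[R]_n) :
  quad_form (x *m x^T) v = ((x^T *m v) 0 0) ^+ 2.
Proof.
rewrite /quad_form mulmxA -mulmxA mxE big_ord1 expr2.
by congr (_ * _); rewrite -[v^T *m x]trmxK trmx_mul trmxK mxE.
Qed.

Lemma quad_form_trace n (A : 'M[R]_n) v : quad_form A v = \tr (A *m (v *m v^T)).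
Proof.
by rewrite /quad_form mulmxA mxtrace_mulC mulmxA /mxtrace big_ord1.
Qed.

Lemma quad_form_delta n (A : 'M[R]_n) j : quad_form A (delta_mx j 0) = A j j.
Proof. by rewrite /quad_form trmx_delta -rowE -colE !mxE. Qed.

Lemma delta_mx_neq0 n (j : 'I_n) : delta_mx j 0 != 0 :> 'cV[R]_n.
Proof.
by apply/eqP => /matrixP /(_ j 0) /eqP; rewrite !mxE !eqxx oner_eq0.
Qed.

Lemma posdef_quad_ge0 n (A : 'M[R]_n) v : posdef A -> 0 <= quad_form A v.
Proof.
move=> [_ pA]; have [->|v0] := eqVneq v 0; last exact/ltW/pA.
by rewrite /quad_form mulmx0 mxE.
Qed.

Lemma posdef_possemidef n (A : 'M[R]_n) : posdef A -> possemidef A.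
Proof. by move=> pA; split; [case: pA|move=> v; exact: posdef_quad_ge0]. Qed.

Lemma posdef1 n : posdef (1%:M : 'M[R]_n).
Proof.
split=> [|v v0]; first exact: trmx1.
by rewrite lt_neqAle eq_sym quad_form1_eq0 v0 quad_form1_ge0.
Qed.

Lemma posdefZ n (A : 'M[R]_n) a : 0 < a -> posdef A -> posdef (a *: A).
Proof.
move=> a0 [sA pA]; split=> [|v v0]; first by rewrite linearZ /= sA.
by rewrite quad_formZ mulr_gt0 // pA.
Qed.

Lemma unitmx_inj n (A : 'M[R]_n) :
  (forall v : 'cV[R]_n, A *m v = 0 -> v = 0) -> A \in unitmx.
Proof.
move=> injA; rewrite -unitmx_tr -row_free_unit -kermx_eq0.
apply/rowV0P => v /sub_kermxP vA; apply: trmx_inj; rewrite trmx0.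
by apply: injA; apply: trmx_inj; rewrite trmx_mul trmxK trmx0.
Qed.

Lemma mulmx1_invmx n (A B : 'M[R]_n) : A *m B = 1%:M -> invmx A = B.
Proof.
by move=> AB; have [uA _] := mulmx1_unit AB; rewrite -[LHS]mulmx1 -AB mulKmx.
Qed.

Lemma invmx_diag n (d : 'rV[R]_n) : (forall j, 0 < d 0 j) ->
  invmx (diag_mx d) = diag_mx (\row_j (d 0 j)^-1).
Proof.
move=> d0; apply: mulmx1_invmx; rewrite mulmx_diag -diag_const_mx.
by congr diag_mx; apply/rowP => j; rewrite !mxE divff // gt_eqF.
Qed.

Lemma posdef_unitmx n (A : 'M[R]_n) : posdef A -> A \in unitmx.
Proof.
move=> [_ pA]; apply: unitmx_inj => v Av; apply/eqP.
have [//|/pA] := eqVneq v 0.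
by rewrite /quad_form -mulmxA Av mulmx0 mxE ltxx.
Qed.

Lemma posdef_congr n (A P : 'M[R]_n) :
  P \in unitmx -> posdef A -> posdef (P *m A *m P^T).
Proof.
move=> uP [sA pA]; split=> [|v v0].
  by rewrite !trmx_mul trmxK sA mulmxA.
rewrite quad_form_congr; apply: pA; apply: contra_neq v0 => Pv.
have uPT : P^T \in unitmx by rewrite unitmx_tr.
by rewrite -(mulKmx uPT v) Pv mulmx0.
Qed.

(** With [u = B *m v], the form at [v + t *: u] is a polynomial in t without constant term and with
    linear coefficient 2|u|^2. It would be negative for small negative t unless [u = 0]. *)
Lemma possemidef_kernel n (B : 'M[R]_n) v :
  possemidef B -> quad_form B v = 0 -> B *m v = 0.
Proof.
move=> [sB pB] v0; set u := B *m v.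
have uu : (v^T *m B *m u) 0 0 = quad_form 1%:M u.
  by rewrite /quad_form mulmx1 trmx_mul sB.
have uv : (u^T *m B *m v) 0 0 = quad_form 1%:M u.
  by rewrite /quad_form mulmx1 -mulmxA.
set a := quad_form 1%:M u in uu uv; set b := quad_form B u.
have expand t : quad_form B (v + t *: u) = t * (2 * a) + t ^+ 2 * b.
  rewrite quad_form_polar v0 quad_form_scale [(t *: u)^T]linearZ /=.
  rewrite -!(scalemxAl, scalemxAr) [(t *: (v^T *m B *m u)) _ _]mxE
    [(t *: (u^T *m B *m v)) _ _]mxE uu uv.
  by rewrite /b; ring.
have a0 : 0 <= a by exact: quad_form1_ge0.
have b0 : 0 <= b by exact: pB.
have b1 : 0 < b + 1 by rewrite ltr_wpDl.
(* The choice is t = -a / (b + 1): adding 1 keeps the denominator positive when [b = 0], and t(2a +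
   tb) is still negative as soon as a > 0. *)
have := pB (v + (- (a / (b + 1))) *: u); rewrite expand => h.
apply/eqP; rewrite -quad_form1_eq0 -/a eq_le a0 andbT.
rewrite leNgt; apply/negP => a_gt0.
have : a / (b + 1) * ((a / (b + 1)) * b - 2 * a) < 0.
  rewrite pmulr_rlt0 ?divr_gt0 // subr_lt0 mulrAC ltr_pdivrMr //.
  nra.
apply/negP; rewrite -leNgt; apply: le_trans h _.
by rewrite le_eqVlt; apply/orP; left; apply/eqP; ring.
Qed.

End QuadraticForms.

(** * Simultaneous diagonalization by congruence *)

Section SimultaneousDiagonalization.
Variable R : realType.

(* The eigenvalue is the minimum of the Rayleigh quotient. *)
Lemma posdef_generalized_eigenvector n (A B : 'M[R]_n.+1) :
  posdef A -> B^T = B ->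
  exists c, exists2 v : 'cV[R]_n.+1, v != 0 & B *m v = c *: (A *m v).
Proof.
move=> pA sB.
(* The Rayleigh quotient is homogeneous of degree zero, so it suffices to minimize it on the unit
   sphere of the matrix norm, which is compact. *)
pose S := [set v : 'rV[R]_n.+1 | `|v| = 1].
pose f (v : 'rV[R]_n.+1) := quad_form B v^T / quad_form A v^T.
have cq (M : 'M[R]_n.+1) (v : 'rV[R]_n.+1) :
    quad_form M u^T @[u --> v] --> quad_form M v^T.
  apply: (@cvg_coord _ _ (nbhs v) _ _
    (fun u : 'rV[R]_n.+1 => u^T^T *m M *m u^T)).
  have vT : u^T @[u --> v] --> v^T.
    by apply: (@cvg_trmx _ _ (nbhs v)); exact: cvg_id.
  apply: (@cvg_mulmx _ _ (nbhs v)) => //.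
  apply: (@cvg_mulmx _ _ (nbhs v)); last exact: cvg_cst.
  exact: (@cvg_trmx _ _ (nbhs v)).
have qA0 (v : 'rV[R]_n.+1) : v != 0 -> 0 < quad_form A v^T.
  by move=> v0; case: pA => _; apply; rewrite trmx_eq0.
have S0 (v : 'rV[R]_n.+1) : v != 0 -> S (`|v|^-1 *: v).
  move=> v0; rewrite /S /= normrZ normfV normr_id mulVf //.
  by rewrite normr_eq0.
have Sn0 (v : 'rV[R]_n.+1) : S v -> v != 0.
  by rewrite /S /=; apply: contra_eq_neq => ->; rewrite normr0 eq_sym oner_eq0.
have cS : compact S.
  apply: bounded_closed_compact.
    by exists 1; split=> // x x1 v /= ->; exact: ltW.
  have cn : continuous (fun v : 'rV[R]_n.+1 => `|v|) by exact: norm_continuous.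
  by move/continuous_closedP: cn => /(_ _ (@closed_eq _ 1)).
have [||v] := @EVT_min_rV R _ f S _ cS.
- exists (`|const_mx 1 : 'rV[R]_n.+1|^-1 *: const_mx 1); apply: S0.
  by apply/eqP => /matrixP /(_ 0 0); rewrite !mxE => /eqP; rewrite oner_eq0.
- apply: continuous_in_subspaceT => v; rewrite inE => /Sn0 v0.
  apply: (cvgM (cq B v)).
  by apply: (cvgV _ (cq A v)); rewrite gt_eqF // qA0.
rewrite inE => Sv minv; exists (f v); exists v^T; first by rewrite trmx_eq0 Sn0.
apply/eqP; rewrite -subr_eq0 scalemxAl -mulmxBl; apply/eqP.
have fA : f v * quad_form A v^T = quad_form B v^T.
  by rewrite /f divfK // gt_eqF // qA0 // Sn0.
(* By minimality [B - f v *: A] is positive semidefinite, and its form vanishes at [v^T]; hence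
   [v^T] lies in its kernel. *)
apply: possemidef_kernel; last by rewrite quad_formB quad_formZ fA subrr.
split=> [|u]; first by rewrite linearB linearZ /= sB; case: pA => ->.
have [->|u0] := eqVneq u 0; first by rewrite /quad_form mulmx0 mxE.
have ut0 : u^T != 0 by rewrite trmx_eq0.
have qAu : 0 < quad_form A u by have := qA0 _ ut0; rewrite trmxK.
rewrite quad_formB quad_formZ subr_ge0 -ler_pdivlMr //.
have := minv (`|u^T|^-1 *: u^T); rewrite inE => /(_ (S0 _ ut0)).
rewrite {2}/f linearZ /= trmxK !quad_form_scale -mulf_div divff ?mul1r //.
by rewrite sqrf_eq0 invr_eq0 normr_eq0.
Qed.

(** Take a generalized eigenvector as first basis vector. The first rows of both matrices are then
    proportional, so a single elimination matrix clears them in both, and the induction continues on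
    the Schur complements. *)
Lemma simultaneous_diagonalization n (A B : 'M[R]_n) :
  posdef A -> B^T = B ->
  exists P : 'M[R]_n, exists2 d : 'rV[R]_n,
    P *m A *m P^T = 1%:M & P *m B *m P^T = diag_mx d.
Proof.
elim: n A B => [|n IH] A B pA sB.
  by exists 1%:M, 0; apply/matrixP => -[].
have [c [v v0 Bv]] := posdef_generalized_eigenvector pA sB.
(* Every row of [M] is [v^T]; [complete_unitmx] replaces [M] by an invertible matrix with the same
   first row. *)
have [g ug gv] : exists2 g : 'M[R]_(1 + n), g \in unitmx & row 0 g = v^T.
  pose U : 'rV[R]_(n.+1) := delta_mx 0 0.
  pose M : 'M[R]_n.+1 := \matrix_(i, j) v j 0.
  have UM : U *m M = v^T.
    by rewrite -rowE; apply/matrixP => i j; rewrite !mxE (ord1 i).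
  have [|g ug] := @complete_unitmx R 1 n.+1 U M.
    rewrite UM !rank_rV trmx_eq0 v0; case: eqP => // /matrixP /(_ 0 0).
    by rewrite !mxE eqxx => /eqP; rewrite oner_eq0.
  by rewrite UM -rowE => gv; exists g.
pose A0 : 'M[R]_(1 + n) := g *m A *m g^T.
pose B0 : 'M[R]_(1 + n) := g *m B *m g^T.
have pA0 : posdef A0 by exact: posdef_congr.
have sA0 : A0^T = A0 by case: pA0.
have sB0 : B0^T = B0 by rewrite /B0 !trmx_mul trmxK sB mulmxA.
(* This is the eigenvector equation read on the first block row. *)
have usubB0 : usubmx B0 = c *: usubmx A0.
  have rowg (M : 'M[R]_(1 + n)) : usubmx (g *m M *m g^T) = v^T *m M *m g^T.
    have -> : usubmx (g *m M *m g^T) = row 0 (g *m M *m g^T).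
      apply/matrixP => i j; rewrite !mxE; apply: eq_bigr => k _.
      rewrite !mxE (ord1 i); congr (_ * _).
      by apply: eq_bigr => l _; congr (g _ _ * _); apply: val_inj.
    by rewrite !row_mul gv.
  rewrite !rowg scalemxAl; congr (_ *m _); apply: trmx_inj.
  rewrite linearZ /= !trmx_mul sB trmxK Bv.
  by case: pA => ->.
pose a := ulsubmx A0 0 0; pose b := ursubmx A0; pose C := drsubmx A0.
have ulA0 : ulsubmx A0 = a%:M by rewrite [LHS]mx11_scalar.
have dlA0 : dlsubmx A0 = b^T by rewrite -[in LHS]sA0 -trmx_ursub.
have A0E : A0 = block_mx a%:M b b^T C by rewrite -ulA0 -dlA0 submxK.
have B0E : B0 = block_mx (c * a)%:M (c *: b) (c *: b)^T (drsubmx B0).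
  rewrite -[LHS]submxK; congr block_mx.
  - by rewrite /ulsubmx usubB0 linearZ /= -/(ulsubmx _) ulA0 scale_scalar_mx.
  - by rewrite /ursubmx usubB0 linearZ.
  - rewrite -[in LHS]sB0 -trmx_ursub; congr (_^T).
    by rewrite /ursubmx usubB0 linearZ.
have a0 : 0 < a.
  have -> : a = quad_form A0 (col_mx 1%:M 0).
    rewrite /quad_form A0E tr_col_mx trmx1 trmx0 mul_row_block mul_row_col.
    by rewrite !mul0mx !addr0 mul1mx mulmx0 addr0 mulmx1 mxE eqxx mulr1n.
  case: pA0 => _; apply; rewrite col_mx_eq0 negb_and; apply/orP; left.
  by apply/eqP => /matrixP /(_ 0 0); rewrite !mxE => /eqP; rewrite oner_eq0.
pose E : 'M[R]_(1 + n) := block_mx 1%:M 0 (- a^-1 *: b^T) 1%:M.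
(* The parameter t treats both matrices at once: t = 1 for [A0] and t = c for [B0]. The matrix [E]
   does not depend on t. *)
have elim_col t D : E *m block_mx (t * a)%:M (t *: b) (t *: b)^T D *m E^T =
    block_mx (t * a)%:M 0 0 (D - (t / a) *: (b^T *m b)).
  rewrite /E tr_block_mx !mulmx_block !(trmx0, trmx1, mul0mx, mulmx0).
  rewrite !(mul1mx, mulmx1, addr0, add0r) !linearZ /= trmxK.
  have tV : t * a * - a^-1 = - t by rewrite mulrN mulfK // gt_eqF.
  have tV' : - a^-1 * (t * a) = - t by rewrite mulrC tV.
  rewrite ?mul_mx_scalar ?mul_scalar_mx -?scalemxAl -?scalemxAr ?scalerA.
  rewrite tV tV' !scaleNr !addNr mul0mx scaler0 oppr0 add0r.
  by congr block_mx; rewrite addrC mulrN scaleNr scalerN.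
have uE : E \in unitmx by rewrite unitmxE det_lblock !det1 mulr1 unitr1.
pose A1 := C - (1 / a) *: (b^T *m b).
pose B1 := drsubmx B0 - (c / a) *: (b^T *m b).
have EA : E *m A0 *m E^T = block_mx a%:M 0 0 A1.
  by have := elim_col 1 C; rewrite mul1r scale1r -A0E.
have EB : E *m B0 *m E^T = block_mx (c * a)%:M 0 0 B1 by rewrite B0E elim_col.
have pA1 : posdef A1.
  have [sE pE] : posdef (E *m A0 *m E^T) by exact: posdef_congr.
  move: sE pE; rewrite EA tr_block_mx => /eq_block_mx [_ _ _ sA1] pE.
  split=> // u u0; have := pE (col_mx 0 u); rewrite col_mx_eq0 negb_and u0 orbT.
  rewrite /quad_form tr_col_mx mul_row_block mul_row_col !trmx0.
  by rewrite !mul0mx !mulmx0 !add0r; apply.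
have sB1 : B1^T = B1.
  have : (E *m B0 *m E^T)^T = E *m B0 *m E^T.
    by rewrite (trmx_mul (E *m B0)) (trmx_mul E) trmxK sB0 mulmxA.
  by rewrite EB tr_block_mx => /eq_block_mx [_ _ _].
have [P1 [d1 PA PB]] := IH A1 B1 pA1 sB1.
pose s := (Num.sqrt a)^-1.
have ssa : s * a * s = 1.
  rewrite /s -[X in _ * X * _]sqr_sqrtr ?ltW // expr2.
  by rewrite mulKf ?mulfV // gt_eqF // sqrtr_gt0.
pose Q : 'M[R]_(1 + n) := block_mx s%:M 0 0 P1.
have QE t D : Q *m block_mx (t * a)%:M 0 0 D *m Q^T =
    block_mx t%:M 0 0 (P1 *m D *m P1^T).
  rewrite /Q tr_block_mx !mulmx_block !(trmx0, mul0mx, mulmx0, addr0, add0r).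
  rewrite tr_scalar_mx -!scalar_mxM; congr (block_mx (_%:M)).
  by rewrite mulrCA -mulrA ssa mulr1.
exists (Q *m E *m g), (row_mx (c%:M) d1).
- rewrite !trmx_mul !mulmxA -[Q *m E *m g *m A]mulmxA -[Q *m E *m _ *m g^T]mulmxA.
  rewrite -/A0 -[Q *m E *m A0]mulmxA -[Q *m _ *m E^T]mulmxA EA.
  by have := QE 1 A1; rewrite mul1r => ->; rewrite PA -scalar_mx_block.
- rewrite !trmx_mul !mulmxA -[Q *m E *m g *m B]mulmxA -[Q *m E *m _ *m g^T]mulmxA.
  rewrite -/B0 -[Q *m E *m B0]mulmxA -[Q *m _ *m E^T]mulmxA EB QE PB.
  have h := diag_mx_row (c%:M : 'rV[R]_1) d1; refine (etrans _ (esym h)).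
  congr block_mx.
  by apply/matrixP => i j; rewrite !mxE !ord1.
Qed.

End SimultaneousDiagonalization.

(** * Pairs of positive definite matrices; inequalities for the logarithm *)

Section PosdefPairs.
Variable R : realType.

Lemma posdef_entry_gt0 n (A : 'M[R]_n) j : posdef A -> 0 < A j j.
Proof. by move=> [_ pA]; rewrite -quad_form_delta pA // delta_mx_neq0. Qed.

(** Reduces statements about two definite matrices, their inverses, traces and determinants to
    statements about the positive numbers [d 0 j]. *)
Lemma posdef_pair_diag n (A B : 'M[R]_n) : posdef A -> posdef B ->
  exists P : 'M[R]_n, exists d : 'rV[R]_n,
    [/\ P *m A *m P^T = 1%:M, P *m B *m P^T = diag_mx d,
        (forall j, 0 < d 0 j), invmx A = P^T *m P &
        invmx B = P^T *m diag_mx (\row_j (d 0 j)^-1) *m P].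
Proof.
move=> pA pB; have sB : B^T = B by case: pB.
have [P [d PA PB]] := simultaneous_diagonalization pA sB.
have uP : P \in unitmx by have := PA; rewrite -mulmxA => /mulmx1_unit [].
have uPT : P^T \in unitmx by rewrite unitmx_tr.
have d0 j : 0 < d 0 j.
  have -> : d 0 j = (P *m B *m P^T) j j by rewrite PB mxE eqxx.
  by apply: posdef_entry_gt0; exact: posdef_congr.
have invE M N : P *m M *m P^T *m N = 1%:M -> invmx M = P^T *m N *m P.
  move=> h; apply: mulmx1_invmx; apply: (can_inj (mulKmx uP)).
  by rewrite mulmx1 !mulmxA h mul1mx.
exists P, d; split=> //.
  by have := invE A 1%:M; rewrite !mulmx1; apply.
apply: invE; rewrite PB -invmx_diag // mulmxV //.
by rewrite -PB; apply: posdef_unitmx; exact: posdef_congr.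
Qed.

Lemma posdef_det_gt0 n (A : 'M[R]_n) : posdef A -> 0 < \det A.
Proof.
move=> pA; have [P [d [PA _ _ _ _]]] := posdef_pair_diag pA pA.
have /(congr1 determinant) := PA; rewrite !det_mulmx det_tr det1 mulrAC -expr2.
move=> h; have PP : 0 < \det P ^+ 2.
  rewrite lt_neqAle sqr_ge0 andbT eq_sym; apply: contra_eq_neq h => ->.
  by rewrite mul0r eq_sym oner_eq0.
by rewrite -(pmulr_rgt0 _ PP) h.
Qed.

Lemma posdef_invmx n (A : 'M[R]_n) : posdef A -> posdef (invmx A).
Proof.
move=> pA; have uA := posdef_unitmx pA.
have -> : invmx A = invmx A *m A *m (invmx A)^T.
  by rewrite mulVmx // mul1mx trmx_inv; case: pA => ->.
by apply: posdef_congr; rewrite ?unitmx_inv.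
Qed.

Lemma posdef_trace_gt0 n (A : 'M[R]_n.+1) : posdef A -> 0 < \tr A.
Proof.
move=> pA; rewrite /mxtrace big_ord_recl ltr_pwDl //; first exact: posdef_entry_gt0.
by apply: sumr_ge0 => j _; apply/ltW/posdef_entry_gt0.
Qed.

Lemma trace_congr n (A P B : 'M[R]_n) : invmx A = P^T *m P ->
  \tr (invmx A *m B) = \tr (P *m B *m P^T).
Proof. by move=> ->; rewrite -(mulmxA P^T) mxtrace_mulC. Qed.

Lemma trace_invmx_mul_gt0 n (A B : 'M[R]_n.+1) : posdef A -> posdef B ->
  0 < \tr (invmx A *m B).
Proof.
move=> pA pB; have [P [d [_ PB d0 Ai _]]] := posdef_pair_diag pA pB.
rewrite (trace_congr _ Ai) PB mxtrace_diag big_ord_recl ltr_pwDl //.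
by apply: sumr_ge0 => j _; exact/ltW.
Qed.

(** In coordinates where [A] becomes 1, the eigenvalues of [invmx B] are the inverses of the
    [d 0 j]; each is at most their sum, which is the trace. *)
Lemma quad_form_invmx_le n (A B : 'M[R]_n) y : posdef A -> posdef B ->
  quad_form (invmx B) y <= quad_form (invmx A) y * \tr (invmx B *m A).
Proof.
move=> pA pB; have [P [d [PA PB d0 Ai Bi]]] := posdef_pair_diag pA pB.
have d0' j : 0 <= (d 0 j)^-1 by rewrite invr_ge0 ltW.
have -> : \tr (invmx B *m A) = \sum_j (d 0 j)^-1.
  rewrite Bi mxtrace_mulC mulmxA mxtrace_mulC !mulmxA PA mul1mx mxtrace_diag.
  by apply: eq_bigr => j _; rewrite mxE.
have -> : quad_form (invmx A) y = quad_form 1%:M (P *m y).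
  by rewrite Ai -[P in RHS]trmxK -quad_form_congr mulmx1 trmxK.
rewrite Bi -[P in _ *m P]trmxK quad_form_congr trmxK quad_form_diag quad_form1.
rewrite mulr_sumr; apply: ler_sum => j _; rewrite mxE mulrC.
by apply: ler_wpM2r => //; rewrite (bigD1 j) //= lerDl sumr_ge0 // => k _; exact: sqr_ge0.
Qed.

(** If the trace vanished, so would every diagonal entry, and [possemidef_kernel] would put all unit
    vectors in the kernel. *)
Lemma possemidef_trace_gt0 n (A : 'M[R]_n) : possemidef A -> A != 0 -> 0 < \tr A.
Proof.
move=> psA A0.
have diag0 j : 0 <= A j j by rewrite -quad_form_delta; apply: psA.2.
rewrite lt_neqAle sumr_ge0 // andbT; apply: contraNneq A0 => /esym tr0.
apply/eqP/matrixP => i j; rewrite mxE.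
have : A *m delta_mx j 0 = 0 :> 'cV[R]_n.
  by apply: (possemidef_kernel psA); rewrite quad_form_delta; exact: (psumr_eq0P _ tr0 isT).
by rewrite -colE => /matrixP /(_ i 0); rewrite !mxE.
Qed.

(** Nonnegativity of the form at the sum and the difference of two unit vectors gives 2|A i j| <= A
    i i + A j j. *)
Lemma possemidef_entry_le n (A : 'M[R]_n) i j : possemidef A -> `|A i j| <= \tr A.
Proof.
move=> psA; have entry a c : A a c = ((delta_mx a 0 : 'cV[R]_n)^T *m A *m
    (delta_mx c 0 : 'cV[R]_n)) 0 0.
  by rewrite trmx_delta -rowE -colE !mxE.
have diag0 a : 0 <= A a a by rewrite entry; exact: psA.2.
have diag_le a : A a a <= \tr A.
  by rewrite /mxtrace (bigD1 a) //= lerDl sumr_ge0.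
have sA : A j i = A i j by rewrite -[in LHS]psA.1 mxE.
pose e a : 'cV[R]_n := delta_mx a 0.
have polar t : quad_form A (e i + t *: e j) = A i i + t ^+ 2 * A j j + t * (2 * A i j).
  rewrite quad_form_polar quad_form_scale [(t *: e j)^T]linearZ /=.
  rewrite -!(scalemxAl, scalemxAr) [(t *: ((e i)^T *m A *m e j)) _ _]mxE.
  rewrite [(t *: ((e j)^T *m A *m e i)) _ _]mxE /quad_form -!entry sA.
  by ring.
have := psA.2 (e i + 1 *: e j); have := psA.2 (e i + (-1) *: e j).
rewrite !polar => h1 h2.
rewrite ler_norml; have := diag_le i; have := diag_le j.
by move=> hj hi; apply/andP; split; lra.
Qed.

Lemma ln_le_subr1 (x : R) : 0 < x -> ln x <= x - 1.
Proof. by move=> x0; rewrite -{1}[x](subrKC 1) le_ln1Dx // ltrBrDl subrr. Qed.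

Lemma ln_eq_subr1 (x : R) : 0 < x -> ln x = x - 1 -> x = 1.
Proof.
move=> x0 h; apply/eqP/negPn/negP => x1.
have lx : ln x != 0 by rewrite ln_eq0.
have := expR_gt1Dx lx; rewrite lnK ?posrE // h addrC subrK.
by rewrite ltxx.
Qed.

Lemma ln_prod (I : Type) (r : seq I) (d : I -> R) :
  (forall i, 0 < d i) -> ln (\prod_(i <- r) d i) = \sum_(i <- r) ln (d i).
Proof.
move=> d0; elim: r => [|i r IH]; first by rewrite !big_nil ln1.
by rewrite !big_cons lnM ?posrE ?IH ?prodr_gt0.
Qed.

Lemma ln_det_diag n (A B P : 'M[R]_n) (d : 'rV[R]_n) :
  posdef A -> posdef B -> (forall j, 0 < d 0 j) ->
  P *m A *m P^T = 1%:M -> P *m B *m P^T = diag_mx d ->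
  ln (\det B) = ln (\det A) + \sum_j ln (d 0 j).
Proof.
move=> pA pB d0 /(congr1 determinant) PA /(congr1 determinant) PB.
move: PA PB; rewrite !det_mulmx det_tr det1 det_diag => PA PB.
have -> : \det B = \det A * \prod_j d 0 j.
  by rewrite -PB -[LHS]mul1r -PA; ring.
by rewrite lnM ?posrE ?ln_prod ?posdef_det_gt0 // prodr_gt0.
Qed.

(** Concavity of log det, with its linearization at [A]: in common coordinates it is ln d <= d - 1,
    summed over the eigenvalues. *)
Lemma ln_det_le n (A B : 'M[R]_n) : posdef A -> posdef B ->
  ln (\det B) - ln (\det A) <= \tr (invmx A *m B) - n%:R.
Proof.
move=> pA pB; have [P [d [PA PB d0 Ai _]]] := posdef_pair_diag pA pB.
rewrite (ln_det_diag pA pB d0 PA PB) (trace_congr _ Ai) PB mxtrace_diag.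
rewrite [ln _ + _]addrC addrK.
have -> : n%:R = \sum_(j < n) (1 : R) by rewrite big_const_ord iter_addr_0.
by rewrite -sumrB; apply: ler_sum => j _; exact: ln_le_subr1.
Qed.

Lemma ln_det_eq n (A B : 'M[R]_n) : posdef A -> posdef B ->
  ln (\det B) - ln (\det A) = \tr (invmx A *m B) - n%:R -> B = A.
Proof.
move=> pA pB; have [P [d [PA PB d0 Ai _]]] := posdef_pair_diag pA pB.
rewrite (ln_det_diag pA pB d0 PA PB) (trace_congr _ Ai) PB mxtrace_diag.
rewrite [ln _ + _]addrC addrK.
have -> : n%:R = \sum_(j < n) (1 : R) by rewrite big_const_ord iter_addr_0.
rewrite -sumrB => /eqP; rewrite eq_sym -subr_eq0 -sumrB => /eqP h.
have d1 j : d 0 j = 1.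
  apply: ln_eq_subr1 => //; apply/eqP; rewrite eq_sym -subr_eq0; apply/eqP.
  apply: (psumr_eq0P (P := xpredT)) h j isT => i _.
  by rewrite subr_ge0 ln_le_subr1.
have uP : P \in unitmx by have := PA; rewrite -mulmxA => /mulmx1_unit [].
have uPT : P^T \in unitmx by rewrite unitmx_tr.
have : P *m B *m P^T = P *m A *m P^T.
  by rewrite PA PB -diag_const_mx; congr diag_mx; apply/rowP => j; rewrite mxE.
by move/(can_inj (mulmxK uPT))/(can_inj (mulKmx uP)).
Qed.

Lemma posdef_diag_mx n (d : 'rV[R]_n) : (forall j, 0 < d 0 j) -> posdef (diag_mx d).
Proof.
move=> d0; split=> [|v v0]; first exact: tr_diag_mx.
have [j vj] : exists j, v j 0 != 0.
  apply/existsP; apply: contraNT v0; rewrite negb_exists => /forallP v0.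
  apply/eqP/matrixP => i k; rewrite (ord1 k) mxE; apply/eqP.
  by have := v0 i; rewrite negbK.
rewrite quad_form_diag (bigD1 j) //= ltr_pwDl //.
  by rewrite mulr_gt0 // lt_neqAle eq_sym sqrf_eq0 vj sqr_ge0.
by apply: sumr_ge0 => k _; rewrite mulr_ge0 ?sqr_ge0 // ltW.
Qed.

(** This is [ln_det_le] at the diagonal part of [G], where the trace term equals [n]. *)
Lemma hadamard n (G : 'M[R]_n) : posdef G ->
  ln (\det G) <= \sum_j ln (G j j).
Proof.
move=> pG; pose d : 'rV[R]_n := \row_j G j j.
have d0 j : 0 < d 0 j by rewrite mxE posdef_entry_gt0.
have pD : posdef (diag_mx d) by exact: posdef_diag_mx.
have := ln_det_le pD pG; rewrite invmx_diag //.
have -> : \tr (diag_mx (\row_j (d 0 j)^-1) *m G) = n%:R.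
  have -> : n%:R = \sum_(j < n) (1 : R) by rewrite big_const_ord iter_addr_0.
  apply: eq_bigr => j _; rewrite mul_diag_mx !mxE mulVf //.
  by rewrite gt_eqF // posdef_entry_gt0.
rewrite subrr subr_le0 det_diag ln_prod //.
by under eq_bigr do rewrite mxE.
Qed.

(** The tangent bound ln(d/m) <= d/m - 1 at the mean m, averaged with the weights; the right side
    averages to zero. *)
Lemma jensen_ln n (p d : 'I_n -> R) :
  (forall j, 0 <= p j) -> \sum_j p j = 1 -> (forall j, 0 < d j) ->
  0 < \sum_j p j * d j /\
  \sum_j p j * ln (d j) <= ln (\sum_j p j * d j).
Proof.
move=> p0 p1 d0; set m := \sum_j p j * d j.
have m0 : 0 < m.
  have [j pj] : exists j, p j != 0.
    apply/existsP; apply: contraT; rewrite negb_exists => /forallP pz.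
    move/eqP: p1; rewrite big1 ?(eq_sym 0) ?oner_eq0 // => j _.
    by apply/eqP; have := pz j; rewrite negbK.
  rewrite /m (bigD1 j) //= ltr_pwDl //.
    by rewrite mulr_gt0 // lt_neqAle eq_sym pj p0.
  by apply: sumr_ge0 => k _; rewrite mulr_ge0 // ltW.
split=> //; rewrite -subr_le0 -[ln m]mul1r -p1 mulr_suml -sumrB.
have : \sum_j p j * (d j / m - 1) = 0.
  under eq_bigr do rewrite mulrBr mulr1 mulrA.
  by rewrite sumrB -mulr_suml -/m p1 divff ?subrr // gt_eqF.
move=> h; rewrite -[leRHS]h; apply: ler_sum => j _; rewrite -mulrBr ler_wpM2l //.
by rewrite -ln_div ?posrE // ln_le_subr1 // divr_gt0.
Qed.

(** Equality makes a sum of nonnegative tangent gaps vanish, so the gap is zero at every index of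
    nonzero weight. *)
Lemma jensen_ln_eq n (p d : 'I_n -> R) j :
  (forall j, 0 <= p j) -> \sum_j p j = 1 -> (forall j, 0 < d j) ->
  \sum_j p j * ln (d j) = ln (\sum_j p j * d j) ->
  p j != 0 -> d j = \sum_j p j * d j.
Proof.
move=> p0 p1 d0; have [m0 _] := jensen_ln p0 p1 d0.
set m := \sum_j p j * d j in m0 *; move=> h pj.
have : \sum_j p j * (d j / m - 1 - ln (d j / m)) = 0.
  transitivity (\sum_j (p j * (d j / m - 1) - (p j * ln (d j) - p j * ln m))).
    by apply: eq_bigr => k _; rewrite ln_div ?posrE //; ring.
  rewrite sumrB [X in _ - X]sumrB h -mulr_suml p1 mul1r subrr subr0.
  under eq_bigr do rewrite mulrBr mulr1 mulrA.
  by rewrite sumrB -mulr_suml -/m p1 divff ?subrr // gt_eqF.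
move=> h2; have dm k : 0 < d k / m by rewrite divr_gt0.
have /eqP : p j * (d j / m - 1 - ln (d j / m)) = 0.
  apply: (psumr_eq0P _ h2 isT) => i _.
  by rewrite mulr_ge0 // subr_ge0 ln_le_subr1.
rewrite mulf_eq0 (negbTE pj) /= subr_eq0 eq_sym => /eqP /(ln_eq_subr1 (dm j)).
by move/(congr1 ( *%R^~ m)); rewrite mul1r divfK // gt_eqF.
Qed.

End PosdefPairs.

(** * Optimal frames *)

Section FiniteBounds.
Variable R : realType.

Lemma fin_upper_bound (I : finType) (f : I -> R) :
  exists2 C, 0 < C & forall i, f i <= C.
Proof.
exists (1 + \sum_i `|f i|); first by rewrite ltr_pwDl // sumr_ge0.
move=> i; rewrite (bigD1 i) //=; apply: (le_trans (ler_norm _)).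
by rewrite addrCA lerDl addr_ge0 // sumr_ge0.
Qed.

Lemma fin_lower_bound (I : finType) (f : I -> R) :
  (forall i, 0 < f i) -> exists2 c, 0 < c & forall i, c <= f i.
Proof.
move=> f0; have [C C0 fC] := fin_upper_bound (fun i => (f i)^-1).
exists C^-1 => [|i]; first by rewrite invr_gt0.
by rewrite -[leRHS]invrK lef_pV2 ?posrE ?invr_gt0.
Qed.

End FiniteBounds.

Section Frames.
Variables (R : realType) (k : nat) (I : finType).
Local Notation n := k.+1.
Variable y : I -> 'cV[R]_n.

Definition frame_mx (f : {ffun 'I_n -> I}) : 'M[R]_n :=
  \matrix_(a, j) y (f j) a 0.

Lemma frame_mx_col f j : col j (frame_mx f) = y (f j).
Proof. by apply/matrixP => a c; rewrite !mxE (ord1 c). Qed.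

(* The strictly decreasing weights make the minimizer sorted. *)
Lemma optimal_frame (l : I -> R) (f0 : {ffun 'I_n -> I}) :
  frame_mx f0 \in unitmx ->
  exists f : {ffun 'I_n -> I}, [/\ frame_mx f \in unitmx,
    (forall j j' : 'I_n, (j <= j')%N -> l (f j) <= l (f j')) &
    (forall i j, (invmx (frame_mx f) *m y i) j 0 != 0 -> l (f j) <= l i)].
Proof.
move=> uf0; pose c (f : {ffun 'I_n -> I}) := \sum_(j < n) (n - j)%:R * l (f j).
pose f := [arg min_(f < f0 | frame_mx f \in unitmx) c f]%O.
have [uf minf] : frame_mx f \in unitmx /\
    forall g, frame_mx g \in unitmx -> c f <= c g.
  by rewrite /f; case: arg_minP => // g ug ming; split.
exists f; split=> //.
- move=> j j'; rewrite leq_eqVlt => /orP[/eqP/val_inj ->//|jj'].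
  (* Swapping the entries at j and j' changes [c] by the difference of the two weights times
     [l (f j') - l (f j)]; minimality makes this nonnegative. *)
  pose g := [ffun a => f (tperm j j' a)].
  have ug : frame_mx g \in unitmx.
    have -> : frame_mx g = col_perm (tperm j j') (frame_mx f).
      by apply/matrixP => a b; rewrite !mxE ffunE.
    by rewrite col_permE unitmx_mul uf unitmx_perm.
  have := minf g ug; rewrite /c.
  have nj : j' != j by rewrite neq_ltn jj' orbT.
  rewrite (bigD1 j) //= (bigD1 j') //= [leRHS](bigD1 j) //=.
  rewrite [X in _ <= _ + X](bigD1 j') //=.
  rewrite !ffunE tpermL tpermR.
  have -> : \sum_(i < n | (i != j) && (i != j')) (n - i)%:R * l (g i) =
            \sum_(i < n | (i != j) && (i != j')) (n - i)%:R * l (f i).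
    by apply: eq_bigr => i /andP[ij ij']; rewrite ffunE tpermD // eq_sym.
  rewrite !addrA lerD2r => h.
  have nn : ((n - j')%:R : R) < (n - j)%:R.
    by rewrite ltr_nat ltn_sub2l // (leq_trans jj') // ltnW.
  move: nn h; set a := (n - j')%:R; set b := (n - j)%:R; move=> ab h.
  have : 0 <= (b - a) * (l (f j') - l (f j)) by nra.
  by rewrite pmulr_rge0 ?subr_gt0 // subr_ge0.
(* Exchange: replacing the vector in position j by [y i] keeps a basis because the j-th coordinate
   of [y i] is nonzero. [E] is the identity with column j replaced by these coordinates. *)
- move=> i j cj; pose g := [ffun a => if a == j then i else f a].
  set v := invmx (frame_mx f) *m y i in cj.
  pose E : 'M[R]_n := \matrix_(a, b) if b == j then v a 0 else (a == b)%:R.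
  have gE : frame_mx g = frame_mx f *m E.
    apply/matrixP => a b; rewrite !mxE ffunE.
    have [->|bj] := eqVneq b j.
      rewrite -[y i](mulKVmx uf) -/v mxE; apply: eq_bigr => l' _.
      by rewrite [E _ _]mxE eqxx.
    rewrite (bigD1 b) //= !mxE (negbTE bj) eqxx mulr1 big1 ?addr0 // => l' lb.
    by rewrite !mxE (negbTE bj) (negbTE lb) mulr0.
  have uE : E \in unitmx.
    apply: unitmx_inj => u Eu.
    have Ea a : v a 0 * u j 0 + (if a == j then 0 else u a 0) = 0.
      transitivity ((E *m u) a 0); last by rewrite Eu mxE.
      rewrite [RHS]mxE (bigD1 j) //= [E _ _]mxE eqxx; congr (_ + _).
      have [->|aj] := eqVneq a j.
        rewrite big1 // => l' lj; rewrite [E _ _]mxE (negbTE lj).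
        by rewrite eq_sym (negbTE lj) mul0r.
      rewrite (bigD1 a) //= [E _ _]mxE (negbTE aj) eqxx mul1r big1 ?addr0 // => l'.
      by case/andP=> lj la; rewrite [E _ _]mxE (negbTE lj) eq_sym (negbTE la) mul0r.
    have uj : u j 0 = 0.
      have := Ea j; rewrite eqxx addr0 => /eqP.
      by rewrite mulf_eq0 (negbTE cj) => /eqP.
    apply/matrixP => a b; rewrite (ord1 b) mxE; have [->//|aj] := eqVneq a j.
    by have := Ea a; rewrite uj mulr0 add0r (negbTE aj).
  have ug : frame_mx g \in unitmx by rewrite gE unitmx_mul uf.
  have := minf g ug; rewrite /c (bigD1 j) //= [leRHS](bigD1 j) //= ffunE eqxx.
  have -> : \sum_(a < n | a != j) (n - a)%:R * l (g a) =
            \sum_(a < n | a != j) (n - a)%:R * l (f a).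
    by apply: eq_bigr => a aj; rewrite ffunE (negbTE aj).
  by rewrite lerD2r ler_pM2l // ltr0n subn_gt0.
Qed.

End Frames.

(** * Abel summation over sorted levels *)

Section AbelSummation.
Variables (R : realType) (k N : nat) (w b delta : R).
Local Notation n := k.+1.

(** Each [u j] is [u ord_max] minus the consecutive gaps above j. Sums of [u] thus become counts of
    indices at most m, weighted by the gaps, and [count_s] compares these counts gap by gap. *)
Lemma abel_lower_bound (u : 'I_n -> R) (s : 'I_N -> 'I_n) :
  (forall j j' : 'I_n, (j <= j')%N -> u j <= u j') ->
  w * N%:R + b = n%:R ->
  (forall m, (m < k)%N -> w * (\sum_i (s i <= m)%N%:R) + delta <= m.+1%:R) ->
  \sum_j u j + delta * (u ord_max - u ord0) <=
    w * (\sum_i u (s i)) + b * u ord_max.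
Proof.
move=> u_mono wbE count_s; pose g m : R := u (inord m.+1) - u (inord m).
have g0 m : (m < k)%N -> 0 <= g m.
  move=> mk; rewrite subr_ge0; apply: u_mono.
  by rewrite !inordK ?leqnSn // ltnS ltnW.
have uE (j : 'I_n) : u j = u ord_max - \sum_(m < k) g m * (j <= m)%N%:R.
  have jk : (j <= k)%N by rewrite -ltnS.
  have -> : \sum_(m < k) g m * (j <= m)%N%:R = \sum_(j <= m < k) g m.
    rewrite -(big_mkord xpredT (fun m => g m * (j <= m)%N%:R)).
    rewrite (big_cat_nat (n := j)) //= [X in X + _]big_nat big1 ?add0r; last first.
      by move=> i /andP[_ ij]; rewrite leqNgt ij mulr0.
    rewrite big_nat [RHS]big_nat; apply: eq_bigr => i /andP[ji _].
    by rewrite ji mulr1.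
  rewrite (telescope_sumr (fun m => u (inord m))) // inord_val.
  have -> : inord k = ord_max :> 'I_n by apply: val_inj; rewrite /= inordK.
  by ring.
have u_sum (J : finType) (h : J -> 'I_n) : \sum_(i : J) u (h i) =
    #|J|%:R * u ord_max - \sum_(m < k) g m * (\sum_i (h i <= m)%N%:R).
  under eq_bigr do rewrite uE.
  rewrite sumrB sumr_const mulr_natl; congr (_ - _); rewrite exchange_big /=.
  by apply: eq_bigr => i _; rewrite mulr_sumr.
have -> : u ord_max - u ord0 = \sum_(m < k) g m.
  rewrite [u ord0]uE opprB addrCA subrr addr0.
  by apply: eq_bigr => m _; rewrite mulr1.
rewrite (u_sum _ s) (u_sum _ id) !card_ord -subr_ge0.
(* The multiples of [u ord_max] cancel because [w * N%:R + b = n%:R]; each gap keeps the slack in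
   [count_s]. *)
have -> : w * (N%:R * u ord_max - \sum_(m < k) g m * (\sum_i (s i <= m)%N%:R)) +
     b * u ord_max - (n%:R * u ord_max -
     \sum_(m < k) g m * (\sum_(i < n) (i <= m)%N%:R) + delta * \sum_(m < k) g m) =
   \sum_(m < k) g m * (\sum_(i < n) (i <= m)%N%:R -
     (w * (\sum_i (s i <= m)%N%:R) + delta)).
  transitivity (\sum_(m < k) g m * (\sum_(i < n) (i <= m)%N%:R) - (
     w * (\sum_(m < k) g m * (\sum_i (s i <= m)%N%:R)) + delta * \sum_(m < k) g m)).
    by rewrite -wbE; ring.
  rewrite !mulr_sumr -big_split -sumrB; apply: eq_bigr => m _ /=.
  by ring.
apply: sumr_ge0 => m _; rewrite mulr_ge0 ?g0 // subr_ge0.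
have -> : \sum_(i < n) (i <= m)%N%:R = m.+1%:R :> R; last exact: count_s.
have mn : (m.+1 <= n)%N by rewrite ltnS ltnW.
rewrite (eq_bigr (fun i : 'I_n => if (i < m.+1)%N then 1 else 0)) => [|i _].
  rewrite -big_mkcond /= -(big_mkord (fun i => (i < m.+1)%N) (fun=> 1)).
  rewrite -(big_nat_widen _ _ _ xpredT (fun=> 1) mn).
  by rewrite big_const_nat subn0 iter_addr_0.
by rewrite ltnS; case: ifP.
Qed.

End AbelSummation.

(** * Condition number from determinant and trace *)

Section Conditioning.
Variables (R : realType) (k : nat).
Local Notation n := k.+1.

(** Write t for the trace of the inverse. The eigenvalues of [S] are at least 1/t, and the
    determinant bound makes them at most 1/(ct), so the trace of [S] is at most n/(ct). *)
Lemma det_trace_conditioning (S : 'M[R]_n) c v : posdef S -> 0 < c ->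
  c * \tr (invmx S) ^+ n <= \det (invmx S) ->
  c / n%:R * \tr S * quad_form 1%:M v <= quad_form S v.
Proof.
move=> pS c0; have [P [d [PP PS d0 Pi Si]]] := posdef_pair_diag (posdef1 R n) pS.
rewrite mulmx1 in PP; rewrite invmx1 in Pi.
set t := \tr (invmx S) => le_c.
have tE : t = \sum_j (d 0 j)^-1.
  rewrite /t Si -mulmxA mxtrace_mulC -mulmxA PP mulmx1 mxtrace_diag.
  by apply: eq_bigr => j _; rewrite mxE.
have t0 : 0 < t by apply: posdef_trace_gt0; exact: posdef_invmx.
have detE : \det (invmx S) = \prod_j (d 0 j)^-1.
  rewrite Si !det_mulmx det_tr mulrAC -{1}det_tr -det_mulmx -Pi det1 mul1r.
  by rewrite det_diag; apply: eq_bigr => j _; rewrite mxE.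
have dt j : (d 0 j)^-1 <= t.
  by rewrite tE (bigD1 j) //= lerDl sumr_ge0 // => i _; rewrite invr_ge0 ltW.
(* Among the n eigenvalues of the inverse, the k others are at most t, so the remaining one is at
   least c t. *)
have dc j : d 0 j <= (c * t)^-1.
  rewrite -[d 0 j]invrK lef_pV2 ?posrE ?invr_gt0 ?mulr_gt0 //.
  rewrite -(ler_pM2r (exprn_gt0 k t0)) -mulrA -exprS; apply: (le_trans le_c).
  rewrite detE (bigD1 j) //= ler_wpM2l ?invr_ge0 ?(ltW (d0 j)) //.
  have -> : t ^+ k = \prod_(i < n | i != j) t.
    by rewrite prodr_const cardC1 card_ord.
  by apply: ler_prod => i _; rewrite dt invr_ge0 ltW.
have trS : \tr S = \sum_j d 0 j.
  have -> : \tr S = \tr (P *m S *m P^T) by rewrite -mulmxA mxtrace_mulC -mulmxA -Pi mulmx1.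
  by rewrite PS mxtrace_diag.
have quadS : quad_form S v = \sum_j d 0 j * (P *m v) j 0 ^+ 2.
  have -> : S = P^T *m diag_mx d *m P by rewrite -PS !mulmxA -Pi mul1mx -mulmxA -Pi mulmx1.
  by rewrite -[P in _ *m P]trmxK quad_form_congr trmxK quad_form_diag.
have quad1 : quad_form 1%:M v = \sum_j (P *m v) j 0 ^+ 2.
  rewrite Pi -[P^T]mulmx1 -[P in _ *m P]trmxK quad_form_congr trmxK.
  by rewrite quad_form1.
rewrite quadS quad1 mulr_sumr; apply: ler_sum => j _; rewrite ler_wpM2r ?sqr_ge0 //.
apply: (@le_trans _ _ t^-1); last first.
  by rewrite -[leRHS]invrK lef_pV2 ?posrE ?invr_gt0.
rewrite mulrAC ler_pdivrMr ?ltr0n //.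
apply: (@le_trans _ _ (c * (n%:R * (c * t)^-1))).
  rewrite ler_wpM2l ?(ltW c0) // trS; apply: (le_trans (ler_sum _ (fun j _ => dc j))).
  by rewrite sumr_const card_ord mulr_natl.
by rewrite invfM mulrCA mulVKf ?gt_eqF // mulrC.
Qed.

End Conditioning.

(** * The normalized cost and its fixed-point iteration *)

Section NormalizedCost.
Variables (R : realType) (k N : nat).
Local Notation n := k.+1.
Variables (x : 'I_N -> 'cV[R]_n) (T : 'M[R]_n) (w b : R).

Definition ncost (S : 'M[R]_n) : R :=
  ln (\det S) + w * (\sum_i ln (quad_form (invmx S) (x i)))
  + b * ln (\tr (invmx S *m T)).

Definition nupdate (S : 'M[R]_n) : 'M[R]_n :=
  w *: (\sum_i (quad_form (invmx S) (x i))^-1 *: (x i *m (x i)^T))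
  + b *: ((\tr (invmx S *m T))^-1 *: T).

Definition subspace_count (V : {vspace 'cV[R]_n}) : R := \sum_i (x i \in V)%:R.

Hypothesis x_neq0 : forall i, x i != 0.
Hypothesis pT : posdef T.
Hypothesis w_gt0 : 0 < w.
Hypothesis b_ge0 : 0 <= b.
Hypothesis wbE : w * N%:R + b = n%:R.
Hypothesis count_lt_dim : forall V : {vspace 'cV[R]_n}, (1 <= \dim V <= k)%N ->
  w * subspace_count V < (\dim V)%:R.

Lemma subspace_countE V : subspace_count V = #|[pred i | x i \in V]|%:R.
Proof.
rewrite -sum1_card natr_sum big_mkcond /=; apply: eq_bigr => i _.
by rewrite inE; case: ifP.
Qed.

(** Infinitely many subspaces give only finitely many pairs of a count and a dimension, so the
    strict inequalities have a common margin. The bound uses some m above the dimension because it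
    is applied to spans of m vectors. *)
Lemma subspace_count_gap : exists2 delta, 0 < delta &
  forall (V : {vspace 'cV[R]_n}) m, (\dim V <= m <= n)%N -> (\dim V < n)%N ->
  (0 < m)%N -> w * subspace_count V + delta <= m%:R.
Proof.
(* The value 1 at pairs violating the inequality only keeps [f] positive. *)
pose f (cm : 'I_N.+1 * 'I_n.+1) : R :=
  if w * cm.1%:R < cm.2%:R then cm.2%:R - w * cm.1%:R else 1.
have [cm|delta d0 fd] := @fin_lower_bound _ _ f.
  by rewrite /f; case: ifP => // lt; rewrite subr_gt0.
exists delta => // V m /andP[dimm mn] dimn m0.
have lt_m : w * subspace_count V < m%:R.
  have [d0'|d1] := posnP (\dim V); last first.
    by apply: (lt_le_trans (count_lt_dim _)); rewrite ?d1 ?ler_nat.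
  rewrite /subspace_count big1 ?mulr0 ?ltr0n // => i _.
  move/eqP: d0'; rewrite dimv_eq0 => /eqP ->.
  by rewrite memv0 (negbTE (x_neq0 i)).
have cN : (#|[pred i | x i \in V]| < N.+1)%N.
  by rewrite ltnS -[X in (_ <= X)%N]card_ord max_card.
have mn' : (m < n.+1)%N by rewrite ltnS.
have := fd (Ordinal cN, Ordinal mn'); rewrite /f /= -subspace_countE lt_m.
by rewrite lerBrDl.
Qed.

Lemma quad_invmx_gt0 S i : posdef S -> 0 < quad_form (invmx S) (x i).
Proof. by move=> /posdef_invmx [_]; apply. Qed.

Lemma trace_invmx_T_gt0 S : posdef S -> 0 < \tr (invmx S *m T).
Proof. by move=> pS; exact: trace_invmx_mul_gt0. Qed.

Lemma quad_nupdate S v : quad_form (nupdate S) v =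
  w * (\sum_i (quad_form (invmx S) (x i))^-1 * ((x i)^T *m v) 0 0 ^+ 2)
  + b * ((\tr (invmx S *m T))^-1 * quad_form T v).
Proof.
rewrite quad_formD !quad_formZ quad_form_sum; congr (w * _ + _).
by apply: eq_bigr => i _; rewrite quad_formZ quad_form_outer.
Qed.

(** For [b > 0] the term in [T] is definite. For [b = 0] a vector of vanishing form is orthogonal to
    all samples, which then lie in a proper subspace; the gap at m = n gives w N + d <= n = w N. *)
Lemma nupdate_posdef S : posdef S -> posdef (nupdate S).
Proof.
move=> pS; split=> [|v v0].
  rewrite linearD !linearZ /= linear_sum /=; case: pT => -> _; congr (_ *: _ + _).
  by apply: eq_bigr => i _; rewrite linearZ /= trmx_mul trmxK.
rewrite quad_nupdate; have T0 := trace_invmx_T_gt0 pS.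
have Tv : 0 < quad_form T v by case: pT => _; exact.
have summand0 i :
    0 <= (quad_form (invmx S) (x i))^-1 * ((x i)^T *m v) 0 0 ^+ 2.
  by rewrite mulr_ge0 ?sqr_ge0 // invr_ge0 ltW // quad_invmx_gt0.
have [b0|b0] := eqVneq b 0; last first.
  apply: ltr_wpDl; first by rewrite mulr_ge0 ?sumr_ge0 // ltW.
  by rewrite !mulr_gt0 ?invr_gt0 // lt_neqAle eq_sym b0 b_ge0.
rewrite b0 mul0r addr0 mulr_gt0 // lt_neqAle sumr_ge0 // andbT.
apply/eqP => /esym sum0.
have xv i : v^T *m x i = 0.
  have /eqP : (quad_form (invmx S) (x i))^-1 * ((x i)^T *m v) 0 0 ^+ 2 = 0.
    by apply: (psumr_eq0P _ sum0 isT).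
  rewrite mulf_eq0 invr_eq0 gt_eqF ?quad_invmx_gt0 //= sqrf_eq0 => /eqP h.
  apply: trmx_inj; rewrite trmx_mul trmxK trmx0.
  by apply/matrixP => a c; rewrite !ord1 h mxE.
pose V : {vspace 'cV[R]_n} := lker (linfun (mulmx v^T : 'cV[R]_n -> 'cV[R]_1)).
have xV i : x i \in V by rewrite memv_ker lfunE /= xv.
have dimV : (\dim V < n)%N.
  have := (dimv_leqif_eq (subvf V)).
  rewrite dimvf /dim /= muln1 => /ltn_leqif ->; apply/eqP => Vf.
  have : v \in V by rewrite Vf memvf.
  rewrite memv_ker lfunE /= => /eqP /matrixP /(_ 0 0) /eqP.
  rewrite [X in _ == X]mxE => vv.
  have : quad_form 1%:M v == 0 by rewrite /quad_form mulmx1.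
  by rewrite quad_form1_eq0 (negbTE v0).
have [d d0 /(_ V n)] := subspace_count_gap.
rewrite (ltnW dimV) leqnn => /(_ isT dimV isT).
rewrite /subspace_count; under eq_bigr do rewrite xV.
rewrite sumr_const card_ord -wbE b0 addr0.
by rewrite -lerBrDl subrr leNgt d0.
Qed.

(** * Descent under the update *)

Lemma trace_mul_nupdate C S : \tr (C *m nupdate S) =
  w * (\sum_i (quad_form (invmx S) (x i))^-1 * quad_form C (x i))
  + b * ((\tr (invmx S *m T))^-1 * \tr (C *m T)).
Proof.
rewrite mulmxDr -!scalemxAr mxtraceD !mxtraceZ; congr (w * _ + _).
rewrite mulmx_sumr raddf_sum /=; apply: eq_bigr => i _.
by rewrite -scalemxAr mxtraceZ (quad_form_trace C).
Qed.

(** With this value of the trace, [ln_det_le] shows that the update does not increase the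
    determinant. *)
Lemma trace_invmx_nupdate S : posdef S -> \tr (invmx S *m nupdate S) = n%:R.
Proof.
move=> pS; rewrite trace_mul_nupdate mulVf ?mulr1; last first.
  by rewrite gt_eqF // trace_invmx_T_gt0.
under eq_bigr do rewrite mulVf ?gt_eqF ?quad_invmx_gt0 //.
by rewrite sumr_const card_ord.
Qed.

Lemma ln_sub_le (u v : R) : 0 < u -> 0 < v -> ln u - ln v <= v^-1 * u - 1.
Proof.
move=> u0 v0; rewrite -ln_div ?posrE // mulrC.
by rewrite ln_le_subr1 // mulr_gt0 // invr_gt0.
Qed.

(* Concavity of the logarithm bounds the two logarithmic sums by their
   linearization at [S], whose increment vanishes at [nupdate S]. *)
Lemma ncost_nupdate_le_ln_det S : posdef S ->
  ncost (nupdate S) - ncost S <= ln (\det (nupdate S)) - ln (\det S).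
Proof.
move=> pS; have pM := nupdate_posdef pS; set M := nupdate S in pM *.
have -> : ncost M - ncost S = ln (\det M) - ln (\det S)
  + (w * (\sum_i (ln (quad_form (invmx M) (x i)) -
                  ln (quad_form (invmx S) (x i))))
  + b * (ln (\tr (invmx M *m T)) - ln (\tr (invmx S *m T)))).
  by rewrite sumrB /ncost; ring.
rewrite gerDl.
(* The linearized increment is [\tr (invmx M *m M)] minus w N + b, that is n - n. *)
have zero : 0 = w * (\sum_i ((quad_form (invmx S) (x i))^-1 *
     quad_form (invmx M) (x i) - 1)) + b * ((\tr (invmx S *m T))^-1 * \tr (invmx M *m T) - 1).
  rewrite sumrB sumr_const card_ord; have := trace_mul_nupdate (invmx M) S.
  rewrite -/M mulVmx ?posdef_unitmx // mxtrace1 -wbE => h.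
  by rewrite mulrBr mulrBr mulr1 addrACA -h -opprD subrr.
rewrite [leRHS]zero; apply: lerD; rewrite ler_wpM2l ?(ltW w_gt0) //.
  by apply: ler_sum => i _; apply: ln_sub_le; exact: quad_invmx_gt0.
by apply: ln_sub_le; exact: trace_invmx_T_gt0.
Qed.

Lemma ncost_nupdate_le S : posdef S -> ncost (nupdate S) <= ncost S.
Proof.
move=> pS; rewrite -subr_le0; apply: le_trans (ncost_nupdate_le_ln_det pS) _.
have := ln_det_le pS (nupdate_posdef pS).
by rewrite trace_invmx_nupdate // subrr.
Qed.

(** Without decrease of the cost, [ln_det_le] is an equality, and [ln_det_eq] applies. *)
Lemma ncost_nupdate_fixed S : posdef S ->
  ncost S <= ncost (nupdate S) -> nupdate S = S.
Proof.
move=> pS le; apply: (ln_det_eq pS (nupdate_posdef pS)).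
have := ln_det_le pS (nupdate_posdef pS).
rewrite trace_invmx_nupdate // subrr => h; apply/eqP; rewrite eq_le h /=.
by apply: le_trans (ncost_nupdate_le_ln_det pS); rewrite subr_ge0.
Qed.

(** The determinant contributes n ln c, and the other terms contribute -(w N + b) ln c. *)
Lemma ncostZ S c : 0 < c -> posdef S -> ncost (c *: S) = ncost S.
Proof.
move=> c0 pS; have ucS : c *: S \in unitmx by apply/posdef_unitmx/posdefZ.
rewrite /ncost invmxZ // detZ.
have ci : 0 < c^-1 by rewrite invr_gt0.
rewrite -scalemxAl mxtraceZ !lnM ?posrE ?exprn_gt0 ?posdef_det_gt0
  ?trace_invmx_T_gt0 //.
under eq_bigr do rewrite quad_formZ lnM ?posrE ?quad_invmx_gt0 //.
rewrite big_split /= sumr_const card_ord lnXn // lnV ?posrE //.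
rewrite -[ln c *+ n]mulr_natr -wbE -[- ln c *+ N]mulr_natr.
by ring.
Qed.

(* In coordinates where [A] becomes 1 and [B] becomes [diag_mx d], [e] is the
   inverse of [d], [p i] lists the normalized squares of the coordinates of
   [x i], and [r] is the normalized diagonal of [T]. *)
Lemma fixed_point_coordinates A B : posdef A -> nupdate A = A -> posdef B ->
  exists P : 'M[R]_n, exists e : 'I_n -> R, exists p : 'I_N -> 'I_n -> R,
  exists r : 'I_n -> R,
  [/\ P \in unitmx, (forall j, 0 < e j),
      (forall i j, p i j = 0 -> (P *m x i) j 0 = 0) &
      [/\ (forall i j, 0 <= p i j) , (forall i, \sum_j p i j = 1),
          (forall j, 0 < r j), \sum_j r j = 1 &
      [/\ (forall j, w * (\sum_i p i j) + b * r j = 1),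
          ncost B - ncost A =
            w * (\sum_i (ln (\sum_j p i j * e j) - \sum_j p i j * ln (e j)))
            + b * (ln (\sum_j r j * e j) - \sum_j r j * ln (e j)) &
          forall c, (forall j, e j = c) -> B = c^-1 *: A]]].
Proof.
move=> pA fixA pB; have [P [d [PA PB d0 Ai Bi]]] := posdef_pair_diag pA pB.
have uP : P \in unitmx by have := PA; rewrite -mulmxA => /mulmx1_unit [].
have uPT : P^T \in unitmx by rewrite unitmx_tr.
pose e j := (d 0 j)^-1; pose z i := P *m x i; pose TP := P *m T *m P^T.
have pTP : posdef TP by exact: posdef_congr.
have e0 j : 0 < e j by rewrite invr_gt0.
have qA i : quad_form (invmx A) (x i) = \sum_j z i j 0 ^+ 2.
  rewrite Ai -quad_form1 /z -[P in RHS]trmxK -quad_form_congr.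
  by rewrite mulmx1 trmxK.
have tA : \tr (invmx A *m T) = \sum_j TP j j by rewrite (trace_congr _ Ai).
have qB i : quad_form (invmx B) (x i) = \sum_j z i j 0 ^+ 2 * e j.
  rewrite Bi -[P in _ *m P]trmxK quad_form_congr trmxK quad_form_diag.
  by apply: eq_bigr => j _; rewrite mxE mulrC.
have tB : \tr (invmx B *m T) = \sum_j TP j j * e j.
  rewrite Bi -(mulmxA _ P) -(mulmxA P^T) mxtrace_mulC -!mulmxA.
  rewrite (mulmxA P) -/TP mul_diag_mx.
  by apply: eq_bigr => j _; rewrite !mxE mulrC.
have qA0 i : 0 < quad_form (invmx A) (x i) by exact: quad_invmx_gt0.
have tA0 : 0 < \tr (invmx A *m T) by exact: trace_invmx_T_gt0.
exists P, e, (fun i j => (quad_form (invmx A) (x i))^-1 * z i j 0 ^+ 2).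
exists (fun j => (\tr (invmx A *m T))^-1 * TP j j).
split=> //.
  move=> i j /eqP; rewrite mulf_eq0 invr_eq0 gt_eqF //= sqrf_eq0.
  by move/eqP.
have sp i : \sum_j (quad_form (invmx A) (x i))^-1 * z i j 0 ^+ 2 = 1.
  by rewrite -mulr_sumr -qA mulVf // gt_eqF.
have sr : \sum_j (\tr (invmx A *m T))^-1 * TP j j = 1.
  by rewrite -mulr_sumr -tA mulVf // gt_eqF.
(* This is the j-th diagonal entry of the fixed-point equation in the new coordinates. *)
have col j : w * (\sum_i (quad_form (invmx A) (x i))^-1 * z i j 0 ^+ 2) +
    b * ((\tr (invmx A *m T))^-1 * TP j j) = 1.
  have updE : P *m nupdate A *m P^T =
      w *: (\sum_i (quad_form (invmx A) (x i))^-1 *: (z i *m (z i)^T)) +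
      b *: ((\tr (invmx A *m T))^-1 *: TP).
    rewrite mulmxDr mulmxDl -!scalemxAr -!scalemxAl mulmx_sumr mulmx_suml.
    congr (_ *: _ + _); apply: eq_bigr => i _.
    by rewrite -scalemxAr -scalemxAl trmx_mul !mulmxA.
  have <- : (P *m nupdate A *m P^T) j j = 1 by rewrite fixA PA mxE eqxx.
  rewrite updE [RHS]mxE; congr (_ + _); rewrite [RHS]mxE; congr (_ * _).
    rewrite summxE; apply: eq_bigr => i _; rewrite [RHS]mxE; congr (_ * _).
    by rewrite [RHS]mxE big_ord1 [(z i)^T _ _]mxE expr2.
  by rewrite [RHS]mxE.
split=> //.
- by move=> i j; rewrite mulr_ge0 ?sqr_ge0 // invr_ge0 ltW.
- by move=> j; rewrite mulr_gt0 ?invr_gt0 // posdef_entry_gt0.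
split=> //.
- have lnB i : ln (quad_form (invmx B) (x i)) = ln (quad_form (invmx A) (x i)) +
      ln (\sum_j (quad_form (invmx A) (x i))^-1 * z i j 0 ^+ 2 * e j).
    have qE : \sum_j (quad_form (invmx A) (x i))^-1 * z i j 0 ^+ 2 * e j =
        (quad_form (invmx A) (x i))^-1 * quad_form (invmx B) (x i).
      by rewrite qB mulr_sumr; apply: eq_bigr => j _; rewrite [RHS]mulrA.
    rewrite qE -lnM ?posrE ?mulr_gt0 ?invr_gt0 ?quad_invmx_gt0 //.
    by rewrite mulVKf // gt_eqF.
  have lnT : ln (\tr (invmx B *m T)) = ln (\tr (invmx A *m T)) +
      ln (\sum_j (\tr (invmx A *m T))^-1 * TP j j * e j).
    have qE : \sum_j (\tr (invmx A *m T))^-1 * TP j j * e j =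
        (\tr (invmx A *m T))^-1 * \tr (invmx B *m T).
      by rewrite tB mulr_sumr; apply: eq_bigr => j _; rewrite mulrA.
    rewrite qE -lnM ?posrE ?mulr_gt0 ?invr_gt0 ?trace_invmx_T_gt0 //.
    by rewrite mulVKf // gt_eqF.
  (* Each [ln (d 0 j) = - ln (e j)] is multiplied by the weights of coordinate j, whose sum is 1 by
     [col]. *)
  have lnd : \sum_j ln (d 0 j) = - (w * (\sum_i \sum_j
      (quad_form (invmx A) (x i))^-1 * z i j 0 ^+ 2 * ln (e j)) +
      b * (\sum_j (\tr (invmx A *m T))^-1 * TP j j * ln (e j))).
    rewrite exchange_big !mulr_sumr -big_split /= -sumrN; apply: eq_bigr => j _.
    rewrite -mulr_suml [b * _]mulrA mulrA -mulrDl col mul1r lnV ?posrE // opprK.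
    by [].
  rewrite /ncost (ln_det_diag pA pB d0 PA PB) lnT lnd.
  rewrite (eq_bigr _ (fun i _ => lnB i)).
  by rewrite big_split sumrB /=; ring.
- move=> c ec; have dc : diag_mx d = c^-1 *: (P *m A *m P^T).
    rewrite PA scalemx1 -diag_const_mx; congr diag_mx; apply/rowP => j.
    by rewrite mxE -(ec j) invrK.
  move: dc; rewrite -PB scalemxAl => /(can_inj (mulmxK uPT)).
  by rewrite scalemxAr => /(can_inj (mulKmx uP)).
Qed.

(** * Minimality and uniqueness of fixed points *)

Lemma fixed_point_minimal A B : posdef A -> nupdate A = A -> posdef B ->
  ncost A <= ncost B.
Proof.
move=> pA fixA pB.
have [P [e [p [r [_ e0 _ [p0 p1 r0 r1 [_ costE _]]]]]]] :=
  fixed_point_coordinates pA fixA pB.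
rewrite -subr_ge0 costE addr_ge0 // mulr_ge0 // ?(ltW w_gt0) //.
  apply: sumr_ge0 => i _; rewrite subr_ge0.
  by have [] := jensen_ln (p0 i) (p1 i) e0.
by rewrite subr_ge0; have [] := jensen_ln (fun j => ltW (r0 j)) r1 e0.
Qed.

Lemma fixed_point_minimizer_unique A B :
  posdef A -> nupdate A = A -> posdef B -> ncost B <= ncost A ->
  exists2 c, 0 < c & B = c *: A.
Proof.
move=> pA fixA pB leBA.
have [P [e [p [r [uP e0 pz [p0 p1 r0 r1 [colE costE scalE]]]]]]] :=
  fixed_point_coordinates pA fixA pB.
have gap_p i : 0 <= ln (\sum_j p i j * e j) - \sum_j p i j * ln (e j).
  by rewrite subr_ge0; have [] := jensen_ln (p0 i) (p1 i) e0.
have gap_r : 0 <= ln (\sum_j r j * e j) - \sum_j r j * ln (e j).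
  by rewrite subr_ge0; have [] := jensen_ln (fun j => ltW (r0 j)) r1 e0.
have : ncost B - ncost A = 0.
  by apply/eqP; rewrite eq_le subr_le0 leBA subr_ge0 fixed_point_minimal.
rewrite costE => /eqP; rewrite paddr_eq0; first last.
- by rewrite mulr_ge0.
- by rewrite mulr_ge0 ?(ltW w_gt0) // sumr_ge0.
rewrite !mulf_eq0 (gt_eqF w_gt0) /= => /andP[/eqP eq_p eq_r].
suff ec j : e j = e ord0.
  by exists (e ord0)^-1; [rewrite invr_gt0|apply: scalE].
have [b0|b0] := eqVneq b 0; last first.
  move: eq_r; rewrite (negbTE b0) subr_eq0 eq_sym => /eqP eq_r.
  have em j' : e j' = \sum_j r j * e j.
    apply: (jensen_ln_eq (fun j => ltW (r0 j)) r1 e0 eq_r).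
    by rewrite gt_eqF.
  by rewrite !em.
have em i j1 j2 : p i j1 != 0 -> p i j2 != 0 -> e j1 = e j2.
  have /eqP : ln (\sum_j p i j * e j) - \sum_j p i j * ln (e j) = 0.
    exact: (psumr_eq0P (fun i _ => gap_p i) eq_p isT).
  rewrite subr_eq0 eq_sym => /eqP h p1' p2'.
  rewrite (jensen_ln_eq (p0 i) (p1 i) e0 h p1').
  by rewrite (jensen_ln_eq (p0 i) (p1 i) e0 h p2').
(* By [em], each sample has its nonzero weights either all in [J] or all outside. Those of the first
   kind lie in the span [V] of the corresponding columns of [invmx P]. *)
pose J := [pred j | e j == e ord0].
apply/eqP; apply: contraT => ej.
have card_J : (#|J| < n)%N.
  rewrite -[X in (_ < X)%N]card_ord -(cardC J) -[X in (X < _)%N]addn0 ltn_add2l.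
  by apply/card_gt0P; exists j; rewrite !inE.
have J0 : (0 < #|J|)%N by apply/card_gt0P; exists ord0; rewrite inE /=.
pose V := <<[seq col j (invmx P) | j <- enum J]>>%VS.
have dimV : (\dim V <= #|J|)%N.
  by apply: leq_trans (dim_span _) _; rewrite size_map cardE.
have xV i : (forall j, j \notin J -> p i j = 0) -> x i \in V.
  move=> pJ; have -> : x i = \sum_j (P *m x i) j 0 *: col j (invmx P).
    rewrite -[LHS](mulKmx uP); apply/matrixP => a c; rewrite (ord1 c) mxE summxE.
    by apply: eq_bigr => l _; rewrite !mxE mulrC.
  rewrite memv_suml // => l _; have [lJ|lJ] := boolP (l \in J).
    by apply/memvZ/memv_span/mapP; exists l; rewrite ?mem_enum.
  by rewrite (pz _ _ (pJ _ lJ)) scale0r mem0v.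
have [delta delta0 /(_ V #|J|)] := subspace_count_gap.
rewrite dimV (ltnW card_J) => /(_ isT (leq_ltn_trans dimV card_J) J0).
rewrite leNgt => /negbTE <-.
apply: (@le_lt_trans _ _ (w * subspace_count V)); last by rewrite ltrDl.
(* Summing the coordinate identities over [J] gives #|J| <= w times the number of samples in [V],
   against the gap. *)
have -> : #|J|%:R = \sum_(j in J) (w * (\sum_i p i j)).
  rewrite -sum1_card natr_sum; apply: eq_bigr => l _.
  by rewrite -(colE l) b0 mul0r addr0.
rewrite -mulr_sumr exchange_big /= ler_wpM2l ?(ltW w_gt0) //.
apply: ler_sum => i _.
have [/exists_inP[j1 j1J pj1]|] := boolP [exists j in J, p i j != 0]; last first.
  rewrite negb_exists_in => /forall_inP pJ; rewrite big1 ?ler0n // => l lJ.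
  by apply/eqP; have := pJ l lJ; rewrite negbK.
rewrite xV => [|l]; last first.
  apply: contraNeq => pl; move: j1J; rewrite !inE /= => /eqP <-.
  by rewrite (em i l j1).
by rewrite -(p1 i) [leRHS](bigID J) /= lerDl sumr_ge0.
Qed.

(* The unit vectors make the family span even if the samples do not. *)
Definition spanning_family (i : 'I_N + 'I_n) : 'cV[R]_n :=
  match i with inl i => x i | inr j => delta_mx j 0 end.

Local Notation y := spanning_family.
Local Notation frame := (frame_mx spanning_family).

Lemma spanning_family_neq0 i : y i != 0.
Proof.
by case: i => [i|j] //=; exact: delta_mx_neq0.
Qed.

Lemma quad_spanning_gt0 (W : 'M[R]_n) i : posdef W -> 0 < quad_form W (y i).
Proof. by case=> _; apply; exact: spanning_family_neq0. Qed.

(** * Coercivity of the cost *)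

(** Assign to each sample the last frame vector [s i] in its expansion. Samples with [s i <= m] lie
    in the span of the first m + 1 frame vectors, so the gap bounds their number as
    [abel_lower_bound] requires. *)
Lemma frame_lower_bound delta f (u : 'I_n -> R) (l : 'I_N -> R) :
  (forall (V : {vspace 'cV[R]_n}) m, (\dim V <= m <= n)%N -> (\dim V < n)%N ->
  (0 < m)%N -> w * subspace_count V + delta <= m%:R) ->
  frame f \in unitmx ->
  (forall j j' : 'I_n, (j <= j')%N -> u j <= u j') ->
  (forall i j, (invmx (frame f) *m x i) j 0 != 0 -> u j <= l i) ->
  \sum_j u j + delta * (u ord_max - u ord0) <=
    w * (\sum_i l i) + b * u ord_max.
Proof.
move=> gap uf u_mono u_le.
pose z i := invmx (frame f) *m x i.
have xz i : x i = \sum_j z i j 0 *: y (f j).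
  rewrite -[LHS](mulKVmx uf); apply/matrixP => a c; rewrite (ord1 c) mxE summxE.
  by apply: eq_bigr => j _; rewrite !mxE mulrC.
have [s sP] : exists s : 'I_N -> 'I_n, forall i, z i (s i) 0 != 0 /\
    forall j, z i j 0 != 0 -> (j <= s i)%N.
  apply: (@fin_all_exists _ (fun=> 'I_n) (fun i l0 => z i l0 0 != 0 /\
    forall j, z i j 0 != 0 -> (j <= l0)%N)) => i.
  have [j0 zj0] : exists j, z i j 0 != 0.
    apply/existsP; apply: contraT; rewrite negb_exists => /forallP z0.
    rewrite -(negbTE (x_neq0 i)) xz big1 // => j _.
    by have := z0 j; rewrite negbK => /eqP ->; rewrite scale0r.
  have [j zj max_j] := @arg_maxnP _ j0 (fun j => z i j 0 != 0) (@nat_of_ord n) zj0.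
  by exists j; split=> // j' zj'; exact: max_j.
have count_s m : (m < k)%N -> w * (\sum_i (s i <= m)%N%:R) + delta <= m.+1%:R.
  move=> mk; pose V := <<[seq y (f (inord a)) | a <- iota 0 m.+1]>>%VS.
  have dimV : (\dim V <= m.+1)%N.
    by apply: leq_trans (dim_span _) _; rewrite size_map size_iota.
  have := gap V m.+1; rewrite dimV ltnS (ltnW mk) => /(_ isT).
  move=> /(_ (leq_ltn_trans dimV _) isT); rewrite ltnS => /(_ mk).
  apply: le_trans; rewrite lerD2r ler_wpM2l ?(ltW w_gt0) //.
  apply: ler_sum => i _; have [sm|//] := leqP (s i) m.
  rewrite (_ : x i \in V) // xz memv_suml // => j _.
  have [->|zj] := eqVneq (z i j 0) 0; first by rewrite scale0r mem0v.
  apply/memvZ/memv_span/mapP; exists (val j); last by rewrite inord_val.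
  by rewrite mem_iota add0n ltnS /= (leq_trans _ sm) // (sP i).2.
apply: (le_trans (abel_lower_bound u_mono wbE count_s)).
rewrite lerD2r ler_wpM2l ?(ltW w_gt0) //; apply: ler_sum => i _.
by apply: u_le; exact: (sP i).1.
Qed.

Lemma ncost_coercive c : exists2 kappa, 0 < kappa &
  forall S, posdef S -> ncost S <= c ->
  forall v, kappa * \tr S * quad_form 1%:M v <= quad_form S v.
Proof.
have [delta delta0 gap] := subspace_count_gap.
(* There are finitely many frames, so these constants do not depend on [S], although the optimal
   frame does. *)
have [C1 C1_gt0 leC1] := fin_upper_bound (fun i => ln (quad_form (invmx T) (y i))).
have [C2 C2_gt0 leC2] := fin_upper_bound
  (fun f : {ffun 'I_n -> 'I_N + 'I_n} => - ln (\det (frame f) ^+ 2)).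
have [C3 C3_gt0 leC3] := fin_upper_bound
  (fun f : {ffun 'I_n -> 'I_N + 'I_n} => \tr (invmx (frame f *m (frame f)^T))).
(* For the optimal frame, sum l + delta (max l - min l) <= D + ln det W and ln det W - C2 <= sum l.
   Hence the spread is at most (D + C2) / delta and ln det W >= n max l - E. Dividing by tr W <= C3
   n exp(max l), raised to the power n, gives [kappa]. *)
pose D := c + b * C1.
pose E := n%:R * ((D + C2) / delta) + D.
pose kappa := expR (- E) / (C3 * n%:R) ^+ n.
have C3n : 0 < C3 * n%:R by rewrite mulr_gt0 ?ltr0n.
have kappa0 : 0 < kappa by rewrite divr_gt0 ?expR_gt0 ?exprn_gt0.
exists (kappa / n%:R) => [|S pS cost_le v]; first by rewrite divr_gt0 ?ltr0n.
apply: det_trace_conditioning => //.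
have pW := posdef_invmx pS; set W := invmx S in pW *.
pose l i := ln (quad_form W (y i)).
pose f0 : {ffun 'I_n -> 'I_N + 'I_n} := [ffun j => inr j].
have uf0 : frame f0 \in unitmx.
  have -> : frame f0 = 1%:M.
    by apply/matrixP => a j; rewrite !mxE ffunE /= mxE eqxx andbT.
  exact: unitmx1.
have [f [uf u_mono u_le]] := optimal_frame l uf0.
pose u j := l (f j).
have low := frame_lower_bound gap uf u_mono (fun i j => u_le (inl i) j).
have quadW0 i : 0 < quad_form W (y i) by exact: quad_spanning_gt0.
have trWT0 : 0 < \tr (W *m T) by exact: trace_invmx_mul_gt0.
have umax : l (f ord_max) <= C1 + ln (\tr (W *m T)).
  have q0 : 0 < quad_form (invmx T) (y (f ord_max)).
    by apply: quad_spanning_gt0; exact: posdef_invmx.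
  apply: le_trans (lerD (leC1 (f ord_max)) (lexx _)).
  rewrite -lnM ?posrE // ler_ln ?posrE ?mulr_gt0 //.
  exact: quad_form_invmx_le.
have F2 : 0 < \det (frame f) ^+ 2.
  by rewrite lt_neqAle sqr_ge0 andbT eq_sym sqrf_eq0 -unitfE -unitmxE.
(* Hadamard's inequality for the Gram matrix of the frame, whose diagonal entries are the
   exponentials of [l (f j)]. *)
have had : ln (\det W) + ln (\det (frame f) ^+ 2) <= \sum_j l (f j).
  have pG : posdef ((frame f)^T *m W *m frame f).
    by rewrite -[X in _ *m X]trmxK; apply: posdef_congr; rewrite ?unitmx_tr.
  have := hadamard pG; rewrite !det_mulmx det_tr mulrAC -expr2 mulrC.
  rewrite lnM ?posrE ?posdef_det_gt0 // => /le_trans; apply.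
  rewrite le_eqVlt; apply/orP; left; apply/eqP; apply: eq_bigr => j _.
  congr ln; rewrite /quad_form -(frame_mx_col y f j).
  rewrite !mxE; apply: eq_bigr => a _; rewrite !mxE; congr (_ * _).
  by apply: eq_bigr => a' _; rewrite !mxE.
have detW : ln (\det W) = - ln (\det S) by rewrite det_inv lnV ?posrE ?posdef_det_gt0.
move: cost_le; rewrite /ncost -/W -[ln (\det S)]opprK -detW => cost_le.
have bC : b * l (f ord_max) <= b * (C1 + ln (\tr (W *m T))).
  exact: (ler_wpM2l b_ge0 umax).
have spread : l (f ord_max) - l (f ord0) <= (D + C2) / delta.
  rewrite ler_pdivlMr // mulrC; have := leC2 f; rewrite /D.
  by move: low had cost_le bC; rewrite /l /=; lra.
have spread0 : 0 <= l (f ord_max) - l (f ord0) by rewrite subr_ge0 u_mono.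
have sum_low : n%:R * l (f ord0) <= \sum_j l (f j).
  have -> : n%:R * l (f ord0) = \sum_(j < n) l (f ord0).
    by rewrite sumr_const card_ord mulr_natl.
  by apply: ler_sum => j _; exact: u_mono.
have lndetW : n%:R * l (f ord_max) - E <= ln (\det W).
  have h1 : n%:R * (l (f ord_max) - l (f ord0)) <= n%:R * ((D + C2) / delta).
    by rewrite ler_wpM2l.
  have h2 : 0 <= delta * (l (f ord_max) - l (f ord0)).
    by rewrite mulr_ge0 // ltW.
  by move: low cost_le bC sum_low h1 h2; rewrite /E /D /l /=; lra.
have trW : \tr W <= C3 * n%:R * expR (l (f ord_max)).
  pose F := frame f *m (frame f)^T.
  have pF : posdef F.
    have -> : F = frame f *m 1%:M *m (frame f)^T by rewrite mulmx1.
    by apply: posdef_congr => //; exact: posdef1.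
  have trWF : \tr (W *m F) <= n%:R * expR (l (f ord_max)).
    have -> : \tr (W *m F) = \sum_j quad_form W (y (f j)).
      rewrite /F mulmxA mxtrace_mulC /mxtrace; apply: eq_bigr => j _.
      rewrite /quad_form -(frame_mx_col y f j) mulmxA.
      rewrite !mxE; apply: eq_bigr => a _; rewrite !mxE; congr (_ * _).
      by apply: eq_bigr => a' _; rewrite !mxE.
    have -> : n%:R * expR (l (f ord_max)) = \sum_(j < n) expR (l (f ord_max)).
      by rewrite sumr_const card_ord mulr_natl.
    apply: ler_sum => j _; rewrite -[leLHS]lnK ?posrE // ler_expR.
    by apply: u_mono; rewrite -ltnS.
  (* [quad_form_invmx_le] at each unit vector, summed over the diagonal. *)
  have trF : \tr W <= \tr (invmx F) * \tr (W *m F).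
    rewrite /mxtrace mulr_suml; apply: ler_sum => j _.
    by rewrite -!quad_form_delta; exact: quad_form_invmx_le.
  apply: (le_trans trF); rewrite -mulrA; apply: ler_pM => //.
  - by apply/ltW/posdef_trace_gt0/posdef_invmx.
  - by apply/ltW/trace_invmx_mul_gt0.
  - exact: leC3.
have tW0 : 0 <= \tr W by apply/ltW/posdef_trace_gt0.
rewrite -[leRHS]lnK ?posrE ?posdef_det_gt0 //.
apply: (@le_trans _ _ (expR (n%:R * l (f ord_max) - E))); last by rewrite ler_expR.
have -> : kappa * \tr W ^+ n = \tr W ^+ n / (C3 * n%:R) ^+ n * expR (- E).
  by rewrite /kappa mulrC mulrA mulrAC.
rewrite expRD expRM_natl.
apply: ler_wpM2r; first exact: expR_ge0.
rewrite ler_pdivrMr ?exprn_gt0 // -exprMn mulrC.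
by rewrite lerXn2r // nnegrE // ?mulr_ge0 ?expR_ge0 // ltW.
Qed.

(** * Continuity, and the cost near singular matrices *)

Lemma cvg_ncost (U : Type) (F : set_system U) (f : U -> 'M[R]_n)
    (A : 'M[R]_n) :
  Filter F -> posdef A -> f t @[t --> F] --> A ->
  ncost (f t) @[t --> F] --> ncost A.
Proof.
move=> FF pA fA; have fi := cvg_invmx FF (posdef_unitmx pA) fA.
apply: cvgD; [apply: cvgD|].
- by apply: cvg_ln; [exact: posdef_det_gt0|exact: cvg_det].
- apply: cvgM; first exact: cvg_cst.
  apply: cvg_bigsum => i _; apply: cvg_ln; first exact: quad_invmx_gt0.
  exact: cvg_quad_form.
- apply: cvgM; first exact: cvg_cst.
  apply: cvg_ln; first exact: trace_invmx_T_gt0.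
  by apply: cvg_mxtrace; apply: cvg_mulmx => //; exact: cvg_cst.
Qed.

Lemma cvg_nupdate (U : Type) (F : set_system U) (f : U -> 'M[R]_n)
    (A : 'M[R]_n) :
  Filter F -> posdef A -> f t @[t --> F] --> A ->
  nupdate (f t) @[t --> F] --> nupdate A.
Proof.
move=> FF pA fA; have fi := cvg_invmx FF (posdef_unitmx pA) fA.
apply: cvgD; apply: cvgZ; try exact: cvg_cst.
- apply: cvg_bigsum => i _; apply: cvgZ; last exact: cvg_cst.
  by apply: cvgV; [rewrite gt_eqF // quad_invmx_gt0|exact: cvg_quad_form].
- apply: cvgZ; last exact: cvg_cst.
  apply: cvgV; first by rewrite gt_eqF // trace_invmx_T_gt0.
  by apply: cvg_mxtrace; apply: cvg_mulmx => //; exact: cvg_cst.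
Qed.

(** At [A] the coercivity inequality fails strictly for some [v], since the trace is positive. By
    continuity it fails nearby, where the cost must then exceed c. *)
Lemma ncost_lower_near_singular (A : 'M[R]_n) c :
  possemidef A -> A != 0 -> ~ posdef A ->
  \forall S \near A, posdef S -> c <= ncost S.
Proof.
move=> psA A0 npA; have trA := possemidef_trace_gt0 psA A0.
have [v v0 Av] : exists2 v, v != 0 & quad_form A v <= 0.
  apply: contrapT => h; apply: npA; split=> [|v v0]; first exact: psA.1.
  by rewrite ltNge; apply/negP => Av; apply: h; exists v.
have [kappa kappa0 coercive] :=
  ncost_coercive c.
have lim : quad_form S v - kappa * \tr S * quad_form 1%:M v @[S --> A] -->
    quad_form A v - kappa * \tr A * quad_form 1%:M v.
  have qv : quad_form S v @[S --> A] --> quad_form A v.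
    apply: (@cvg_quad_form R _ (nbhs A) n id); exact: cvg_id.
  have tv : \tr S @[S --> A] --> \tr A.
    apply: (@cvg_mxtrace R _ (nbhs A) n id); exact: cvg_id.
  exact: (cvgB qv (cvgM (cvgM (cvg_cst _) tv) (cvg_cst _))).
have q1 : 0 < quad_form 1%:M v by case: (posdef1 R n) => _; exact.
have neg : quad_form A v - kappa * \tr A * quad_form 1%:M v < 0.
  by rewrite subr_lt0 (le_lt_trans Av) // !mulr_gt0.
apply: filterS (cvgr_lt _ lim _ neg) => S; rewrite subr_lt0 => lt pS.
rewrite leNgt; apply/negP => /ltW /(coercive S pS) /(_ v).
by rewrite leNgt lt.
Qed.

(** * Convergence of the normalized iteration *)

Definition nstep (S : 'M[R]_n) := (\tr (nupdate S))^-1 *: nupdate S.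

Lemma nstep_posdef S : posdef S -> posdef (nstep S).
Proof.
move=> pS; have pM : posdef (nupdate S) by exact: nupdate_posdef.
by apply: posdefZ => //; rewrite invr_gt0 posdef_trace_gt0.
Qed.

Lemma nstep_trace S : posdef S -> \tr (nstep S) = 1.
Proof.
move=> pS; rewrite mxtraceZ mulVf // gt_eqF // posdef_trace_gt0 //.
exact: nupdate_posdef.
Qed.

Lemma ncost_nstep S : posdef S -> ncost (nstep S) = ncost (nupdate S).
Proof.
move=> pS; have pM : posdef (nupdate S) by exact: nupdate_posdef.
by apply: ncostZ => //; rewrite invr_gt0 posdef_trace_gt0.
Qed.

Variable S0 : 'M[R]_n.
Hypothesis pS0 : posdef S0.

Local Notation S_ t := (iter t nstep S0).

Lemma iter_nstep_posdef t : posdef (S_ t).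
Proof. by elim: t => //= t IH; exact: nstep_posdef. Qed.

Lemma iter_nstep_cost_le s t : (s <= t)%N -> ncost (S_ t) <= ncost (S_ s).
Proof.
elim: t => [|t IH]; first by rewrite leqn0 => /eqP ->.
rewrite leq_eqVlt => /orP[/eqP -> //|]; rewrite ltnS => /IH; apply: le_trans.
rewrite iterS ncost_nstep; last exact: iter_nstep_posdef.
by apply: ncost_nupdate_le => //; exact: iter_nstep_posdef.
Qed.

(** A cluster point is the limit of a proper filter [G] finer than that of the sequence, and closed
    conditions on the iterates pass to the limit along [G]. *)
Lemma iter_nstep_limit_fixed (G : set_system 'M[R]_n) (A : 'M[R]_n) :
  ProperFilter G ->
  G --> A -> S_ t @[t --> \oo] `<=` G ->
  [/\ posdef A, \tr A = 1 & nupdate A = A].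
Proof.
move=> PG GA subG.
have [kappa kappa0 coercive] :=
  ncost_coercive (ncost S0).
have nearG (P : 'M[R]_n -> Prop) s : (forall t, (s <= t)%N -> P (S_ t)) ->
    \forall M \near G, P M.
  by move=> SP; apply: subG; exists s => // t; exact: SP.
have GA' : M @[M --> G] --> A by exact: GA.
have limit_ge (f : 'M[R]_n -> R) (a : R) : f M @[M --> G] --> f A ->
    (\forall M \near G, a <= f M) -> a <= f A.
  by move=> fA fa; exact: (closed_cvg (fun r => a <= r) (@closed_ge _ a) fa _ fA).
have limit_le (f : 'M[R]_n -> R) (a : R) : f M @[M --> G] --> f A ->
    (\forall M \near G, f M <= a) -> f A <= a.
  by move=> fA fa; exact: (closed_cvg (fun r => r <= a) (@closed_le _ a) fa _ fA).
have trA : \tr A = 1.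
  have cA : \tr M @[M --> G] --> \tr A by exact: cvg_mxtrace.
  (* The start [S0] is not normalized, so the trace is 1 only from index 1 on. *)
  have tr1 : \forall M \near G, \tr M = 1.
    apply: (nearG _ 1%N) => -[//|t] _; rewrite iterS nstep_trace //.
    exact: iter_nstep_posdef.
  apply/eqP; rewrite eq_le (limit_le (fun M => \tr M)) ?(limit_ge (fun M => \tr M)) //;
    by apply: filterS tr1 => M ->.
have sA : A^T = A.
  apply/matrixP => i j; rewrite mxE; apply/eqP; rewrite -subr_eq0.
  have cA : (M : 'M[R]_n) j i - (M : 'M[R]_n) i j @[M --> G] --> A j i - A i j.
    by apply: cvgB; exact: (@cvg_coord R _ G _ _ id).
  have sym : \forall M \near G, (M : 'M[R]_n) j i - (M : 'M[R]_n) i j = 0.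
    apply: (nearG _ 0%N) => t _; have [st _] := iter_nstep_posdef t.
    by rewrite -[in X in X - _]st mxE subrr.
  rewrite eq_le (limit_le (fun M : 'M[R]_n => M j i - M i j))
    ?(limit_ge (fun M : 'M[R]_n => M j i - M i j)) //;
    by apply: filterS sym => M ->.
have pA : posdef A.
  split=> // v v0; apply: (@lt_le_trans _ _ (kappa * quad_form 1%:M v)).
    by rewrite mulr_gt0 //; case: (posdef1 R n) => _; exact.
  apply: (limit_ge (fun M => quad_form M v)); first exact: cvg_quad_form.
  apply: (nearG _ 1%N) => -[//|t] _; have pt := iter_nstep_posdef t.+1.
  have := coercive _ pt (iter_nstep_cost_le (leq0n _)) v.
  by rewrite {1}iterS nstep_trace ?mulr1 //; exact: iter_nstep_posdef.
have cost_le t : ncost A <= ncost (S_ t).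
  apply: limit_le; first exact: cvg_ncost.
  by apply: (nearG _ t) => s; exact: iter_nstep_cost_le.
split=> //; have pM := nupdate_posdef pA.
(* [ncost A] is below the cost of every iterate, hence below the limit of the costs at t + 1, which
   is [ncost (nupdate A)]. *)
apply: ncost_nupdate_fixed => //.
apply: (limit_ge (fun M => ncost (nupdate M))).
  apply: cvg_ncost => //; exact: cvg_nupdate.
apply: (nearG _ 0%N) => t _.
by rewrite -ncost_nstep ?(cost_le t.+1) //; exact: iter_nstep_posdef.
Qed.

(** In a compact set of a Hausdorff space, a sequence with a single cluster point converges to
    it. *)
Lemma iter_nstep_cvg : exists A,
  [/\ S_ t @[t --> \oo] --> A, posdef A & nupdate A = A].
Proof.
(* Entries of the iterates are at most 1 from index 1 on; the bound 2 makes the box a neighbourhood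
   of the cluster point. *)
pose V := [set M : 'M[R]_n | forall i j, `|M i j| <= 2].
have cV : compact V by exact: compact_mx_box.
have FV : (S_ t @[t --> \oo]) V.
  exists 1%N => // -[//|t] _ i j; have pt := iter_nstep_posdef t.
  apply: (@le_trans _ _ 1); last by rewrite ler1n.
  rewrite -(nstep_trace pt); apply: possemidef_entry_le.
  by apply: posdef_possemidef; exact: nstep_posdef.
have cluster_fixed B : cluster (S_ t @[t --> \oo]) B ->
    [/\ posdef B, \tr B = 1 & nupdate B = B].
  rewrite cluster_cvgE => -[G PG [GB subG]].
  exact: (iter_nstep_limit_fixed PG GB subG).
have [A [VA clA]] := cV _ _ FV.
have [pA trA fixA] := cluster_fixed A clA.
exists A; split=> //.
have hM : hausdorff_space 'M[R]_n by exact: norm_hausdorff.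
apply: (compact_cluster_set1 hM cV _ _ FV).
- exists (fun i j => [set r | `|r| <= 2]) => // i j.
  have lt2 : `|A i j| < 2.
    apply: (@le_lt_trans _ _ 1); last by rewrite ltr1n.
    by rewrite -trA; apply/possemidef_entry_le/posdef_possemidef.
  have := @norm_continuous R R (A i j).
  move/(cvgr_lt (FF := nbhs_filter (A i j))) => /(_ _ lt2).
  by apply: filterS => r /ltW.
- apply/seteqP; split=> [B clB|_ ->//].
  have [pB trB fixB] := cluster_fixed B clB.
  (* Both fixed points are minimal, hence proportional, and their common trace 1 makes them
     equal. *)
  have leBA : ncost B <= ncost A by exact: fixed_point_minimal.
  have [c c0 BE] : exists2 c, 0 < c & B = c *: A.
    exact: (fixed_point_minimizer_unique pA fixA pB).
  by move: trB; rewrite BE mxtraceZ trA mulr1 => ->; rewrite scale1r.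
Qed.

End NormalizedCost.

(** * Wiesel's cost *)

Section WieselCost.
Variables (R : realType) (k N : nat).
Local Notation n := k.+1.
Variables (x : 'I_N -> 'cV[R]_n) (T : 'M[R]_n) (alpha0 : R).
Hypothesis N_gt0 : (0 < N)%N.
Hypothesis x_neq0 : forall i, x i != 0.
Hypothesis pT : posdef T.
Hypothesis alpha0_ge0 : 0 <= alpha0.
Hypothesis hP : forall V : {vspace 'cV[R]_n}, (1 <= \dim V <= k)%N ->
  sample_prop x V < (1 + alpha0) * (\dim V)%:R / n%:R.

Definition sample_weight : R := (1 + alpha0)^-1 * (n%:R / N%:R).
Definition shape_weight : R := alpha0 / (1 + alpha0) * n%:R.

Local Notation w := sample_weight.
Local Notation b := shape_weight.

Let a1_gt0 : 0 < 1 + alpha0. Proof. by rewrite ltr_pwDl. Qed.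
Let n_gt0 : 0 < n%:R :> R. Proof. by rewrite ltr0n. Qed.
Let NR_gt0 : 0 < N%:R :> R. Proof. by rewrite ltr0n. Qed.

Lemma sample_weight_gt0 : 0 < w.
Proof. by rewrite mulr_gt0 ?invr_gt0 ?divr_gt0. Qed.

Lemma shape_weight_ge0 : 0 <= b.
Proof. by rewrite mulr_ge0 // divr_ge0 // ltW. Qed.

Lemma weightsE : w * N%:R + b = n%:R.
Proof.
rewrite /sample_weight /shape_weight; move: NR_gt0.
by set K := n%:R; set M := N%:R => M0; field; rewrite !gt_eqF.
Qed.

Lemma weighted_count_lt_dim (V : {vspace 'cV[R]_n}) : (1 <= \dim V <= k)%N ->
  w * subspace_count x V < (\dim V)%:R.
Proof.
move=> /hP; rewrite /sample_prop -/(subspace_count x V) => lt.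
have -> : w * subspace_count x V =
    (n%:R / (1 + alpha0)) * (N%:R^-1 * subspace_count x V).
  by rewrite /sample_weight; ring.
have -> : (\dim V)%:R =
    (n%:R / (1 + alpha0)) * ((1 + alpha0) * (\dim V)%:R / n%:R) :> R.
  move: n_gt0; set K := n%:R => K0.
  by field; rewrite !gt_eqF.
by rewrite ltr_pM2l // divr_gt0.
Qed.

Lemma wiesel_updateE S : wiesel_update x T alpha0 S = nupdate x T w b S.
Proof.
rewrite /wiesel_update /nupdate !scalerA; congr (_ + _ *: _).
by rewrite /shape_weight mulrAC.
Qed.

Lemma wiesel_costE S : wiesel_cost x T alpha0 S = (1 + alpha0) * ncost x T w b S.
Proof.
rewrite /wiesel_cost /ncost /sample_weight /shape_weight.
move: (ln _) (\sum_i _) (ln _) => d s t.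
move: n_gt0 NR_gt0; set K := n%:R; set M := N%:R => K0 M0.
by field; rewrite !gt_eqF.
Qed.

Lemma wiesel_cost_ext_posdef S : posdef S ->
  wiesel_cost_ext x T alpha0 S = (wiesel_cost x T alpha0 S)%:E.
Proof. by move=> pS; rewrite /wiesel_cost_ext asboolT. Qed.

(** For each r, the matrices of cost at least r form a set of the filter defining the lower limit,
    whose infimum is then at least r. *)
Lemma wiesel_cost_ext_singular S : possemidef S -> S != 0 -> ~ posdef S ->
  wiesel_cost_ext x T alpha0 S = +oo%E.
Proof.
move=> psS S0 npS; rewrite /wiesel_cost_ext asboolF // limf_einfE.
apply: eq_infty => r; apply: le_ereal_sup_tmp.
pose V := [set A : 'M[R]_n | r <= wiesel_cost x T alpha0 A].
exists (ereal_inf ((fun A => (wiesel_cost x T alpha0 A)%:E) @` V)).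
  exists V => //.
  have := ncost_lower_near_singular x_neq0 pT sample_weight_gt0 shape_weight_ge0
    weightsE weighted_count_lt_dim (r / (1 + alpha0)) psS S0 npS.
  apply: filterS => A leA pA; rewrite /V /= wiesel_costE mulrC -ler_pdivrMr //.
  exact: leA.
by apply: le_ereal_inf_tmp => _ [A VA <-]; rewrite lee_fin.
Qed.

End WieselCost.

Theorem proposition17 (R : realType) (K N : nat) (x : 'I_N -> 'cV[R]_K)
    (T : 'M[R]_K) (alpha0 : R) (Sigma0 : 'M[R]_K)
    (N_gt0 : (0 < N)%N)
    (x_neq0 : forall i : 'I_N, x i != 0)
    (T_posdef : posdef T)
    (alpha0_ge0 : 0 <= alpha0)
    (hP : forall S : {vspace 'cV[R]_K}, (1 <= \dim S <= K.-1)%N ->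
       sample_prop x S < (1 + alpha0) * (\dim S)%:R / K%:R)
    (Sigma0_posdef : posdef Sigma0) :
  exists Sigma : 'M[R]_K,
    [/\ wiesel_iter x T alpha0 Sigma0 t @[t --> \oo] --> Sigma,
        wiesel_minimizer x T alpha0 Sigma &
        forall Sigma' : 'M[R]_K, wiesel_minimizer x T alpha0 Sigma' ->
          exists2 c : R, 0 < c & Sigma' = c *: Sigma].
Proof.
case: K => [|k] in x T Sigma0 x_neq0 T_posdef hP Sigma0_posdef *.
  (* In dimension 0 there is no nonzero sample, while N > 0. *)
  by have := x_neq0 (Ordinal N_gt0); rewrite flatmx0 eqxx.
set w := sample_weight k N alpha0; set b := shape_weight k alpha0.
have w0 : 0 < w by exact: sample_weight_gt0.
have b0 : 0 <= b by exact: shape_weight_ge0.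
have wbE : w * N%:R + b = k.+1%:R by exact: weightsE.
have count := weighted_count_lt_dim alpha0_ge0 hP.
have a1 : 0 < 1 + alpha0 by rewrite ltr_pwDl.
have costE := wiesel_costE x T N_gt0 alpha0_ge0.
have [A [cvgA pA fixA]] := iter_nstep_cvg x_neq0 T_posdef w0 b0 wbE count Sigma0_posdef.
have A_min B : posdef B -> wiesel_cost x T alpha0 A <= wiesel_cost x T alpha0 B.
  move=> pB; rewrite !costE ler_pM2l //.
  exact: fixed_point_minimal.
have A0 : A != 0.
  apply/eqP => A0; have := posdef_trace_gt0 pA.
  by rewrite A0 mxtrace0 ltxx.
exists A; split.
- have -> : wiesel_iter x T alpha0 Sigma0 = fun t => iter t (nstep x T w b) Sigma0.
    apply/funext => t; apply: eq_iter => S.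
    by rewrite /wiesel_step /nstep wiesel_updateE.
  exact: cvgA.
- split; [exact: posdef_possemidef|exact: A0|move=> B psB B0].
  rewrite wiesel_cost_ext_posdef //; have [pB|npB] := pselect (posdef B).
    by rewrite wiesel_cost_ext_posdef // lee_fin A_min.
  by rewrite (wiesel_cost_ext_singular N_gt0 x_neq0) // leey.
- move=> B [psB B0 minB].
  have := minB A (posdef_possemidef pA) A0; rewrite (wiesel_cost_ext_posdef _ _ _ pA).
  (* A singular [B] would have cost [+oo], above the finite cost of [A]. *)
  have [pB|npB] := pselect (posdef B); last first.
    by rewrite (wiesel_cost_ext_singular N_gt0 x_neq0).
  rewrite wiesel_cost_ext_posdef // lee_fin !costE ler_pM2l // => leBA.
  exact: (fixed_point_minimizer_unique x_neq0 T_posdef w0 b0 count pA fixA pB leBA).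
Qed.
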